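(* Let $Z$ be a complex-analytic map from a neighborhood of $0$ in $(\mathbb{C}^d)^{N+1}$ to $\mathbb{C}^d$ with $Z(0,\ldots,0)=0$, and assume $B_0=\partial_0Z(0)$ is non-singular. Let $\boldsymbol\lambda=(\lambda_1,\ldots,\lambda_m)$ be a stable non-resonant vector of eigenvalues with corresponding eigenvectors $v_1,\ldots,v_m$ (i.e. $T(\lambda_j)v_j=0$, $v_j\neq0$), and set $\Lambda=\mathrm{diag}(\lambda_1,\ldots,\lambda_m)$, $V=(v_1\cdots v_m)$. Then there exists a function $P$, analytic on a neighborhood of $0\in\mathbb{C}^m$ with values in $\mathbb{C}^d$, such that $P(0)=0$, $P'(0)=V$, and $$Z\big(P(z),P(\Lambda z),\ldots,P(\Lambda^Nz)\big)=0$$ for all $z$ in a neighborhood of $0$. Moreover, such a $P$ is unique (as a germ of analytic functions at $0$ with $P(0)=0$, $P'(0)=V$).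
   Context: $B_i=\partial_iZ(0)$ denotes the $d\times d$ derivative of $Z$ with respect to its $i$-th block variable, $i=0,\ldots,N$; $T(\lambda)=\sum_{i=0}^N\lambda^iB_i$; $\mathcal{F}(\lambda)=\det T(\lambda)$ is the characteristic polynomial. Multi-index notation: $\boldsymbol\lambda^\alpha=\lambda_1^{\alpha_1}\cdots\lambda_m^{\alpha_m}$, $|\alpha|=\sum\alpha_i$. A vector $\boldsymbol\lambda\in\mathbb{C}^m$ is a stable non-resonant vector of eigenvalues if $|\lambda_i|<1$ and $\mathcal{F}(\lambda_i)=0$ for all $i$, and $\mathcal{F}(\boldsymbol\lambda^\alpha)\ne0$ for all $\alpha\in\mathbb{Z}_+^m$ with $|\alpha|\ge2$. *)

(* Defs.v *)
From Stdlib Require Import Reals.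
Open Scope R_scope.

Record C := mkC { Cre : R ; Cim : R }.
Definition C0 : C := mkC 0 0.
Definition C1 : C := mkC 1 0.
Definition Cadd (a b : C) : C := mkC (Cre a + Cre b) (Cim a + Cim b).
Definition Copp (a : C) : C := mkC (- Cre a) (- Cim a).
Definition Cmul (a b : C) : C :=
  mkC (Cre a * Cre b - Cim a * Cim b) (Cre a * Cim b + Cim a * Cre b).
Fixpoint Cpow (a : C) (k : nat) : C :=
  match k with O => C1 | S k' => Cmul a (Cpow a k') end.
Definition Cnorm (a : C) : R := sqrt (Cre a * Cre a + Cim a * Cim a).

Fixpoint gsum {A : Type} (add : A -> A -> A) (zero : A) (k : nat) (g : nat -> A) : A :=
  match k with O => zero | S k' => add (gsum add zero k' g) (g k') end.
Definition sumC := gsum Cadd C0.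
Definition prodC := gsum Cmul C1.

(* Sum of F alpha over all multi-indices alpha = (alpha_0,...,alpha_{n-1})
   (alpha : nat -> nat, zero outside [0,n)) with |alpha| = k. *)
Fixpoint sum_deg {A : Type} (add : A -> A -> A) (zero : A) (n k : nat)
  (F : (nat -> nat) -> A) : A :=
  match n with
  | O => if Nat.eqb k 0 then F (fun _ => 0%nat) else zero
  | S n' => gsum add zero (S k) (fun j =>
              sum_deg add zero n' (k - j)
                (fun a => F (fun i => if Nat.eqb i n' then j else a i)))
  end.

(* ---------- vectors of C^n and matrices (only indices < n matter) ---------- *)
Definition vec := nat -> C.
Definition mat := nat -> nat -> C.
Definition vzero : vec := fun _ => C0.
Definition vsub (x y : vec) : vec := fun i => Cadd (x i) (Copp (y i)).
Definition vnorm (n : nat) (x : vec) : R := gsum Rmax 0 n (fun i => Cnorm (x i)).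
Definition matvec (n : nat) (A : mat) (x : vec) : vec :=
  fun i => sumC n (fun j => Cmul (A i j) (x j)).

Definition minor (A : mat) (j : nat) : mat :=
  fun i k => A (S i) (if Nat.ltb k j then k else S k).
Fixpoint det (n : nat) (A : mat) : C :=
  match n with
  | O => C1
  | S n' => sumC (S n') (fun j =>
              Cmul (if Nat.even j then C1 else Copp C1)
                   (Cmul (A 0%nat j) (det n' (minor A j))))
  end.

Definition monomial (n : nat) (z : vec) (a : nat -> nat) : C :=
  prodC n (fun i => Cpow (z i) (a i)).
Definition mabs (n : nat) (a : nat -> nat) : nat := gsum Nat.add 0%nat n a.

Definition Cseries (u : nat -> C) (l : C) : Prop :=
  infinite_sum (fun k => Cre (u k)) (Cre l) /\ infinite_sum (fun k => Cim (u k)) (Cim l).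

Definition analytic0 (n p : nat) (f : vec -> vec) : Prop :=
  exists (c : (nat -> nat) -> vec) (r : R), 0 < r /\
    forall z : vec, (forall i, (i < n)%nat -> Cnorm (z i) < r) ->
      forall j, (j < p)%nat ->
        (exists l, infinite_sum
            (fun k => sum_deg Rplus 0 n k (fun a => Cnorm (c a j) * Cnorm (monomial n z a))) l)
        /\ Cseries (fun k => sum_deg Cadd C0 n k (fun a => Cmul (c a j) (monomial n z a)))
                   (f z j).

Definition has_deriv0 (n p : nat) (f : vec -> vec) (L : mat) : Prop :=
  forall eps, 0 < eps -> exists delta, 0 < delta /\
    forall h : vec, vnorm n h < delta ->
      vnorm p (vsub (vsub (f h) (f vzero)) (matvec n L h)) <= eps * vnorm n h.

(* (x_0, ..., x_N) in (C^d)^(N+1), flattened: block k, component i at index k*d+i *)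
Definition blocks (d N : nat) (xs : nat -> vec) : vec :=
  fun idx => if Nat.ltb idx (S N * d) then xs (idx / d)%nat (idx mod d)%nat else C0.

Definition in_block (d N k : nat) (h : vec) : vec :=
  blocks d N (fun j => if Nat.eqb j k then h else vzero).

Definition Tmat (N : nat) (B : nat -> mat) (mu : C) : mat :=
  fun i j => sumC (S N) (fun k => Cmul (Cpow mu k) (B k i j)).

Definition charF (d N : nat) (B : nat -> mat) (mu : C) : C := det d (Tmat N B mu).

Definition lpow (m : nat) (lam : vec) (a : nat -> nat) : C := monomial m lam a.

Definition stable_nonresonant (d N : nat) (B : nat -> mat) (m : nat) (lam : vec) : Prop :=
  (forall j, (j < m)%nat -> Cnorm (lam j) < 1 /\ charF d N B (lam j) = C0) /\
  (forall a : nat -> nat, (2 <= mabs m a)%nat -> charF d N B (lpow m lam a) <> C0).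

Definition Lampow (lam : vec) (k : nat) (z : vec) : vec :=
  fun j => Cmul (Cpow (lam j) k) (z j).

Definition Zcomp (d N : nat) (Z : vec -> vec) (P : vec -> vec) (lam : vec) (z : vec) : vec :=
  Z (blocks d N (fun k => P (Lampow lam k z))).

Definition solves (d N m : nat) (Z : vec -> vec) (P : vec -> vec) (lam : vec) : Prop :=
  exists r, 0 < r /\ forall z : vec, vnorm m z < r ->
    forall i, (i < d)%nat -> Zcomp d N Z P lam z i = C0.

(* Main.v *)
(* Write P = V z + W with W of order at least 2. On the coefficient of z^a the
   linearized equation acts by the matrix T(lam^a), which is invertible for |a| >= 2 by
   non-resonance; since lam^a -> 0 and T(0) = B_0 is invertible, the inverses are
   uniformly bounded. In the norm sum_a |p_a| t^|a|, with t small, the fixed-point map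
   W |-> - T^-1 (nonlinear part of Z)(V z + W) is therefore a contraction, whose Picard
   iterates from V z are Cauchy and converge to P. For uniqueness, the lowest-order
   homogeneous part of the difference of two solutions is in the kernel of the
   linearized operator, so it vanishes by non-resonance. *)

Require Import Defs.
From Stdlib Require Import Reals.
From HB Require structures.
From Corelib Require Import ssreflect ssrbool.
From mathcomp Require all_boot all_order all_algebra boolp mpoly ring zify.
From Stdlib Require Lra Lia.

(** Infinite power series are never substituted into one another. Each Picard step uses a truncation
    of Z, so the iterates are polynomials, their norms are finite sums, and no Banach space of
    series is built. The limit is taken coefficient by coefficient, and the equation passes to the
    limit on values, through Lipschitz bounds uniform in the truncation order. The weighted l1 norm
    is chosen because it is submultiplicative and because |lam^a| <= 1 makes P(z) |-> P(Lambda^k z)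
    non-expanding, so one radius t serves all N+1 blocks. On a ball of radius rho the part of Z of
    degree at least 2 has Lipschitz constant O(rho); rho is taken so small that the fixed-point map
    is 1/4-Lipschitz. The terms of Z that a truncation leaves out add an error decaying like 4^-n,
    and the increments of the iteration still halve at each step. Non-resonance says nothing about
    |a| < 2. There the inverse is set to 0, which freezes P(0) = 0 and P'(0) = V at every step, and
    the linear equation in degree 1 is exactly T(lambda_j) v_j = 0. *)

Module PowerSeries.
Import structures all_boot all_order all_algebra boolp mpoly ring zify.
Ltac cring := ring.
Import Reals Lra Lia Defs.
Set Implicit Arguments. Unset Strict Implicit. Unset Printing Implicit Defensive.
Import GRing.Theory.
Delimit Scope nat_scope with N.
Delimit Scope R_scope with RR.
Delimit Scope ring_scope with R.
Local Open Scope ring_scope.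

(** * Complex numbers and finite sums *)

Lemma C_eq (a b : C) : Cre a = Cre b -> Cim a = Cim b -> a = b.
Proof. by case: a b => [? ?] [? ?] /= -> ->. Qed.

(** Classical decidable equality and choice make [C] a mathcomp field, so that determinants,
    multivariate polynomials and big operators apply to it. *)
HB.instance Definition _ := gen_eqMixin C.
HB.instance Definition _ := gen_choiceMixin C.

Fact C_addA : associative Cadd.
Proof. by move=> a b c; apply: C_eq => /=; lra. Qed.
Fact C_addC : commutative Cadd.
Proof. by move=> a b; apply: C_eq => /=; lra. Qed.
Fact C_add0 : left_id C0 Cadd.
Proof. by move=> a; apply: C_eq => /=; lra. Qed.
Fact C_addN : left_inverse C0 Copp Cadd.
Proof. by move=> a; apply: C_eq => /=; lra. Qed.
HB.instance Definition _ := GRing.isZmodule.Build C C_addA C_addC C_add0 C_addN.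

Fact C_mulA : associative Cmul.
Proof. by move=> a b c; apply: C_eq => /=; ring. Qed.
Fact C_mulC : commutative Cmul.
Proof. by move=> a b; apply: C_eq => /=; ring. Qed.
Fact C_mul1 : left_id C1 Cmul.
Proof. by move=> a; apply: C_eq => /=; ring. Qed.
Fact C_mulDl : left_distributive Cmul Cadd.
Proof. by move=> a b c; apply: C_eq => /=; ring. Qed.
Fact C_1neq0 : C1 != C0.
Proof. by apply/eqP => -[]; lra. Qed.
HB.instance Definition _ :=
  GRing.Zmodule_isComNzRing.Build C C_mulA C_mulC C_mul1 C_mulDl C_1neq0.

Definition Cnorm2 (a : C) : R := (Cre a * Cre a + Cim a * Cim a)%RR.
Definition Cinv (a : C) : C :=
  if a == C0 then C0 else mkC (Cre a / Cnorm2 a)%RR (- Cim a / Cnorm2 a)%RR.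

Lemma Cnorm2_gt0 (a : C) : a <> C0 -> (0 < Cnorm2 a)%RR.
Proof.
move=> an0; rewrite /Cnorm2.
have [re0|ren0] := Req_dec (Cre a) 0; last by nra.
have [im0|imn0] := Req_dec (Cim a) 0; last by nra.
by case: an0; apply: C_eq.
Qed.

Fact C_mulV : forall a : C, a != 0 -> Cmul (Cinv a) a = C1.
Proof.
move=> a an0; rewrite /Cinv; move: (an0); rewrite /negb; case: ifP => // _ _.
move/eqP/Cnorm2_gt0: an0 => a0.
by apply: C_eq; rewrite /= /Cnorm2; field; move: a0; rewrite /Cnorm2; lra.
Qed.
Fact C_inv0 : Cinv 0 = 0.
Proof. by rewrite /Cinv eqxx. Qed.
HB.instance Definition _ := GRing.ComNzRing_isField.Build C C_mulV C_inv0.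

Arguments Cnorm _%_ring_scope.
Arguments Cre _%_ring_scope.
Arguments Cim _%_ring_scope.

Lemma CreB (a b : C) : Cre (a - b) = (Cre a - Cre b)%RR. Proof. by []. Qed.
Lemma CimB (a b : C) : Cim (a - b) = (Cim a - Cim b)%RR. Proof. by []. Qed.

Lemma CmulE : Cmul = @GRing.mul C. Proof. by []. Qed.
Lemma C0E : C0 = 0 :> C. Proof. by []. Qed.

Lemma CpowE (a : C) k : Cpow a k = a ^+ k.
Proof. by elim: k => [|k IH] //; rewrite exprS -IH. Qed.

Lemma Cnorm_ge0 (a : C) : (0 <= Cnorm a)%RR.
Proof. exact: sqrt_pos. Qed.

Lemma Cnorm_sqr (a : C) : (Cnorm a * Cnorm a = Cre a * Cre a + Cim a * Cim a)%RR.
Proof. by apply: sqrt_sqrt; nra. Qed.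

Lemma Rle_sqr a b : (0 <= b -> a * a <= b * b -> a <= b)%RR.
Proof. by move=> b0 ab; nra. Qed.

Lemma Req_sqr a b : (0 <= a -> 0 <= b -> a * a = b * b -> a = b)%RR.
Proof. by move=> a0 b0 ab; apply: Rle_antisym; apply: Rle_sqr; lra. Qed.

Lemma CnormM (a b : C) : (Cnorm (a * b) = Cnorm a * Cnorm b)%RR.
Proof.
apply: Req_sqr; first exact: Cnorm_ge0.
  by apply: Rmult_le_pos; exact: Cnorm_ge0.
have -> : (Cnorm a * Cnorm b * (Cnorm a * Cnorm b) =
  (Cnorm a * Cnorm a) * (Cnorm b * Cnorm b))%RR by ring.
by rewrite !Cnorm_sqr /=; ring.
Qed.

Lemma CnormD (a b : C) : (Cnorm (a + b) <= Cnorm a + Cnorm b)%RR.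
Proof.
have a0 := Cnorm_ge0 a; have b0 := Cnorm_ge0 b.
apply: Rle_sqr; first by lra.
have -> : ((Cnorm a + Cnorm b) * (Cnorm a + Cnorm b) =
  Cnorm a * Cnorm a + Cnorm b * Cnorm b + 2 * (Cnorm a * Cnorm b))%RR by ring.
have cs : (Cre a * Cre b + Cim a * Cim b <= Cnorm a * Cnorm b)%RR.
  apply: Rle_sqr; first exact: Rmult_le_pos.
  have -> : (Cnorm a * Cnorm b * (Cnorm a * Cnorm b) =
    (Cnorm a * Cnorm a) * (Cnorm b * Cnorm b))%RR by ring.
  rewrite !Cnorm_sqr.
  (* Lagrange identity: this square is the gap in the Cauchy-Schwarz inequality. *)
  by have := Rle_0_sqr (Cre a * Cim b - Cim a * Cre b)%RR; rewrite /Rsqr; lra.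
by rewrite !Cnorm_sqr /=; lra.
Qed.

Lemma CnormN (a : C) : Cnorm (- a) = Cnorm a.
Proof. by rewrite /Cnorm /=; congr sqrt; ring. Qed.

Lemma CnormB (a b : C) : Cnorm (a - b) = Cnorm (b - a).
Proof. by rewrite -CnormN opprB. Qed.

Lemma Cnorm_tri (b a c : C) : (Cnorm (a - c) <= Cnorm (a - b) + Cnorm (b - c))%RR.
Proof. by rewrite -(subrKA b a (- c)); exact: CnormD. Qed.

Lemma Cnorm_tril (b a c : C) : (Cnorm (a - c) <= Cnorm (b - a) + Cnorm (b - c))%RR.
Proof. by rewrite (CnormB b); exact: Cnorm_tri. Qed.

Lemma Cnorm_trir (b a c : C) : (Cnorm (a - c) <= Cnorm (a - b) + Cnorm (c - b))%RR.
Proof. by rewrite (CnormB c); exact: Cnorm_tri. Qed.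

Lemma Cnorm0 : Cnorm 0 = 0%RR.
Proof. by rewrite /Cnorm /= Rmult_0_l Rplus_0_l sqrt_0. Qed.

Lemma Cnorm1 : Cnorm 1 = 1%RR.
Proof. by rewrite /Cnorm /= Rmult_0_l Rplus_0_r Rmult_1_l sqrt_1. Qed.

Lemma Cnorm_eq0 (a : C) : Cnorm a = 0%RR -> a = 0.
Proof.
by move=> a0; have := Cnorm_sqr a; rewrite a0 => e; apply: C_eq => /=; nra.
Qed.

Lemma CnormX (a : C) k : Cnorm (a ^+ k) = (Cnorm a ^ k)%RR.
Proof. by elim: k => [|k IH]; rewrite ?expr0 ?Cnorm1 // exprS CnormM IH. Qed.

Lemma Cre_le (a : C) : (Rabs (Cre a) <= Cnorm a)%RR.
Proof.
apply: Rle_sqr; first exact: Cnorm_ge0.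
by rewrite Cnorm_sqr -Rabs_mult Rabs_right; nra.
Qed.

Lemma Cim_le (a : C) : (Rabs (Cim a) <= Cnorm a)%RR.
Proof.
apply: Rle_sqr; first exact: Cnorm_ge0.
by rewrite Cnorm_sqr -Rabs_mult Rabs_right; nra.
Qed.

Lemma Cnorm_le (a : C) : (Cnorm a <= Rabs (Cre a) + Rabs (Cim a))%RR.
Proof.
have r0 := Rabs_pos (Cre a); have i0 := Rabs_pos (Cim a).
apply: Rle_sqr; first lra.
have er : (Rabs (Cre a) * Rabs (Cre a) = Cre a * Cre a)%RR.
  by rewrite -Rabs_mult Rabs_right; nra.
have ei : (Rabs (Cim a) * Rabs (Cim a) = Cim a * Cim a)%RR.
  by rewrite -Rabs_mult Rabs_right; nra.
by rewrite Cnorm_sqr; nra.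
Qed.

Fact Rplus_law_A : associative Rplus. Proof. by move=> *; ring. Qed.
Fact Rplus_law_C : commutative Rplus. Proof. by move=> *; ring. Qed.
Fact Rplus_law_0 : left_id R0 Rplus. Proof. by move=> *; ring. Qed.
HB.instance Definition _ :=
  Monoid.isComLaw.Build R R0 Rplus Rplus_law_A Rplus_law_C Rplus_law_0.

(** Real sums stay apart from [\sum]: the Stdlib reals get only a commutative monoid structure,
    which suffices for reindexing and splitting. *)
Definition rsum (T : Type) (s : seq T) (F : T -> R) : R :=
  \big[Rplus/R0]_(a <- s) F a.

Section Rsum.
Variable T : Type.
Implicit Types (s : seq T) (F G : T -> R).

Lemma rsum_nil F : rsum [::] F = 0%RR. Proof. exact: big_nil. Qed.
Lemma rsum_cons x s F : rsum (x :: s) F = (F x + rsum s F)%RR.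
Proof. exact: big_cons. Qed.
Lemma rsum_cat s1 s2 F : rsum (s1 ++ s2) F = (rsum s1 F + rsum s2 F)%RR.
Proof. exact: big_cat. Qed.
Lemma rsum_map (U : Type) (h : U -> T) (s : seq U) F :
  rsum (map h s) F = rsum s (fun x => F (h x)).
Proof. exact: big_map. Qed.
Lemma rsumD s F G : (rsum s (fun x => F x + G x) = rsum s F + rsum s G)%RR.
Proof. exact: big_split. Qed.
Lemma rsumZ s c F : (rsum s (fun x => c * F x) = c * rsum s F)%RR.
Proof.
by elim: s => [|x s IH]; rewrite ?rsum_nil ?rsum_cons ?IH; ring.
Qed.
Lemma eq_rsum s F G : (forall x, F x = G x) -> rsum s F = rsum s G.
Proof. by move=> FG; apply: eq_bigr => x _; apply: FG. Qed.
Lemma rsum_const s c : rsum s (fun _ => c) = (INR (size s) * c)%RR.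
Proof.
elim: s => [|x s IH]; first by rewrite rsum_nil /=; lra.
by rewrite rsum_cons IH -[size (x :: s)]/(size s).+1 S_INR; ring.
Qed.
Lemma rsum_le s F G : (forall x, F x <= G x)%RR -> (rsum s F <= rsum s G)%RR.
Proof.
move=> FG; elim: s => [|x s IH]; rewrite ?rsum_nil ?rsum_cons; first lra.
by have := FG x; lra.
Qed.
Lemma rsum_ge0 s F : (forall x, 0 <= F x)%RR -> (0 <= rsum s F)%RR.
Proof.
move=> F0; elim: s => [|x s IH]; rewrite ?rsum_nil ?rsum_cons; first lra.
by have := F0 x; lra.
Qed.
End Rsum.

Lemma rsum_le_in (T : eqType) (s : seq T) (F G : T -> R) :
  (forall x, x \in s -> F x <= G x)%RR -> (rsum s F <= rsum s G)%RR.
Proof.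
elim: s => [|x s IH] FG; rewrite ?rsum_nil ?rsum_cons; first lra.
have := FG x (mem_head _ _).
suff : (rsum s F <= rsum s G)%RR by lra.
by apply: IH => y ys; apply: FG; rewrite inE ys orbT.
Qed.

Lemma rsum_mem (T : eqType) (s : seq T) (F : T -> R) x :
  (forall x, 0 <= F x)%RR -> x \in s -> (F x <= rsum s F)%RR.
Proof.
move=> F0; elim: s => [//|y s IH]; rewrite rsum_cons inE => /orP[/eqP->|/IH].
  by have := rsum_ge0 s F0; lra.
by have := F0 y; lra.
Qed.

Lemma Cnorm_sum (T : Type) (s : seq T) (F : T -> C) :
  (Cnorm (\sum_(a <- s) F a)%R <= rsum s (fun a => Cnorm (F a)))%RR.
Proof.
elim: s => [|x s IH]; rewrite ?big_nil ?rsum_nil ?Cnorm0 ?big_cons ?rsum_cons.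
  by lra.
by apply: Rle_trans (CnormD _ _) _; exact: Rplus_le_compat_l.
Qed.

Lemma iotaSr m n : iota m n.+1 = rcons (iota m n) (m + n)%N.
Proof. by rewrite -addn1 iotaD cats1. Qed.

Lemma rsum_iotaS n (F : nat -> R) :
  rsum (iota 0 n.+1) F = (rsum (iota 0 n) F + F n)%RR.
Proof. by rewrite iotaSr -cats1 rsum_cat rsum_cons rsum_nil Rplus_0_r. Qed.

Lemma sum_iotaS (A : nmodType) n (F : nat -> A) :
  \sum_(i <- iota 0 n.+1) F i = \sum_(i <- iota 0 n) F i + F n.
Proof. by rewrite iotaSr -cats1 big_cat /= big_seq1. Qed.

Lemma gsumE (A : Type) (zero : A) (add : Monoid.law zero) n g :
  gsum add zero n g = \big[add/zero]_(i <- iota 0 n) g i.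
Proof.
elim: n => [|n IH]; first by rewrite big_nil.
by rewrite iotaSr -cats1 big_cat /= big_seq1 -IH.
Qed.

Lemma sumCE n g : sumC n g = \sum_(i <- iota 0 n) g i.
Proof. exact: (@gsumE C 0 +%R). Qed.
Lemma prodCE n g : prodC n g = \prod_(i <- iota 0 n) g i.
Proof. exact: (@gsumE C 1 *%R). Qed.

Lemma mabsE n a : mabs n a = (\sum_(i <- iota 0 n) a i)%N.
Proof. exact: (@gsumE nat 0%N addn). Qed.
Lemma mabsS n a : mabs n.+1 a = (mabs n a + a n)%N.
Proof. by []. Qed.

Lemma sum_f_R0E f n : sum_f_R0 f n = rsum (iota 0 n.+1) f.
Proof.
elim: n => [|n IH]; first by rewrite rsum_cons rsum_nil /=; ring.
by rewrite rsum_iotaS -IH.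
Qed.

(** * Convergence in C *)

Definition Ccv (u : nat -> C) (l : C) :=
  forall eps, (0 < eps)%RR -> exists K, forall n, (K <= n)%N -> (Cnorm (u n - l) < eps)%RR.

Lemma Ccv_unique (u : nat -> C) (l l' : C) : Ccv u l -> Ccv u l' -> l = l'.
Proof.
move=> ul ul'; apply/subr0_eq; apply: Cnorm_eq0.
have [lt|//] := Rle_lt_or_eq_dec _ _ (Cnorm_ge0 (l - l')); exfalso.
have [K1 h1] := ul (Cnorm (l - l') / 2)%RR ltac:(lra).
have [K2 h2] := ul' (Cnorm (l - l') / 2)%RR ltac:(lra).
have := h1 _ (leq_maxl K1 K2); have := h2 _ (leq_maxr K1 K2).
set n := maxn _ _ => a b.
have := Cnorm_tril (u n) l l'; lra.
Qed.

Lemma Rle_eps a b : (forall eps, 0 < eps -> a <= b + eps)%RR -> (a <= b)%RR.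
Proof.
move=> h; case: (Rle_lt_dec a b) => // ba.
by have := h ((a - b) / 2)%RR ltac:(lra); lra.
Qed.

Lemma Ccv_le (u : nat -> C) (l v : C) M :
  Ccv u l -> (exists K, forall n, (K <= n)%N -> Cnorm (u n - v) <= M)%RR ->
  (Cnorm (l - v) <= M)%RR.
Proof.
move=> ul [K1 h1]; apply: Rle_eps => eps e0; have [K2 h2] := ul _ e0.
have := h1 _ (leq_maxl K1 K2); have := h2 _ (leq_maxr K1 K2).
set n := maxn _ _ => a b.
have := Cnorm_tril (u n) l v; lra.
Qed.

Lemma CseriesP (u : nat -> C) (l : C) :
  Cseries u l <-> Ccv (fun K => \sum_(k <- iota 0 K) u k) l.
Proof.
have Cre_sum s : Cre (\sum_(k <- s) u k) = rsum s (fun k => Cre (u k)).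
  by elim: s => [|x s IH]; rewrite ?big_nil ?rsum_nil ?big_cons ?rsum_cons -?IH.
have Cim_sum s : Cim (\sum_(k <- s) u k) = rsum s (fun k => Cim (u k)).
  by elim: s => [|x s IH]; rewrite ?big_nil ?rsum_nil ?big_cons ?rsum_cons -?IH.
split=> [[hr hi] eps e0 | h].
  have [K1 h1] := hr (eps / 2)%RR ltac:(lra).
  have [K2 h2] := hi (eps / 2)%RR ltac:(lra).
  (* [sum_f_R0 _ n] includes the term of index [n], whereas the partial sum of index [K] stops at
     [K - 1]; hence the shift by one. *)
  exists (K1 + K2).+1 => -[//|n] leKn.
  have := h1 n ltac:(lia).
  have := h2 n ltac:(lia).
  rewrite /R_dist !sum_f_R0E -Cre_sum -Cim_sum => a b.
  by apply: Rle_lt_trans (Cnorm_le _) _; rewrite CreB CimB; lra.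
split=> eps e0; have [K hK] := h _ e0; exists K => n /leP leKn.
  have := hK n.+1 (leqW leKn); rewrite /R_dist sum_f_R0E -Cre_sum => hn.
  by apply: Rle_lt_trans hn; apply: Rle_trans (Cre_le _); rewrite CreB; apply: Req_le.
have := hK n.+1 (leqW leKn); rewrite /R_dist sum_f_R0E -Cim_sum => hn.
by apply: Rle_lt_trans hn; apply: Rle_trans (Cim_le _); rewrite CimB; apply: Req_le.
Qed.

Lemma Ccv_Cauchy (u : nat -> C) (e : nat -> R) :
  (forall n k, (n <= k)%N -> Cnorm (u k - u n) <= e n)%RR ->
  (forall eps, 0 < eps -> exists n, e n < eps)%RR -> {l | Ccv u l}.
Proof.
move=> ue e0.
have cau f : (forall a b : C, Rabs (f a - f b) <= Cnorm (a - b))%RR ->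
    Cauchy_crit (fun n => f (u n)).
  move=> hf eps eps0; have [n hn] := e0 (eps / 2)%RR ltac:(lra).
  exists n => k k' /leP hk /leP hk'.
  apply: Rle_lt_trans (hf _ _) _.
  have := Cnorm_trir (u n) (u k) (u k').
  by have := ue _ _ hk; have := ue _ _ hk'; lra.
have [lr hr] := R_complete _ (cau Cre (fun a b => Cre_le (a - b))).
have [li hi] := R_complete _ (cau Cim (fun a b => Cim_le (a - b))).
exists (mkC lr li) => eps eps0.
have [K1 h1] := hr (eps / 2)%RR ltac:(lra).
have [K2 h2] := hi (eps / 2)%RR ltac:(lra).
exists (K1 + K2)%N => n hn.
have := h1 n ltac:(lia).
have := h2 n ltac:(lia).
rewrite /R_dist => a b.
by apply: Rle_lt_trans (Cnorm_le _) _; rewrite CreB CimB /=; lra.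
Qed.

(** * Multi-indices and Lipschitz bounds for polynomials *)

Definition miext (n j : nat) (a : nat -> nat) : nat -> nat :=
  fun i => if Nat.eqb i n then j else a i.

(* The multi-indices of degree k in n variables, in the order in which sum_deg
   adds them, with the same functions nat -> nat as representatives. *)
Fixpoint mi (n k : nat) : seq (nat -> nat) :=
  match n with
  | 0%N => if k == 0%N then [:: fun _ => 0%N] else [::]
  | n'.+1 => flatten [seq [seq miext n' j a | a <- mi n' (k - j)] | j <- iota 0 k.+1]
  end.

Lemma miS n k : mi n.+1 k =
  flatten [seq [seq miext n j a | a <- mi n (k - j)] | j <- iota 0 k.+1].
Proof. by []. Qed.

Lemma sum_degE (A : Type) (zero : A) (add : Monoid.law zero) n k F :
  sum_deg add zero n k F = \big[add/zero]_(a <- mi n k) F a.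
Proof.
elim: n k F => [|n IH] k F.
  by case: k => [|k] /=; rewrite ?big_seq1 ?big_nil.
rewrite miS big_flatten big_map [LHS]gsumE.
apply: eq_bigr => j _; rewrite big_map.
exact: (IH (k - j)%N (fun a => F (miext n j a))).
Qed.

Lemma sum_degCE n k F : sum_deg Cadd C0 n k F = \sum_(a <- mi n k) F a.
Proof. exact: (@sum_degE C 0 +%R). Qed.
Lemma sum_degRE n k F : sum_deg Rplus 0%RR n k F = rsum (mi n k) F.
Proof. exact: (@sum_degE R R0 Rplus). Qed.

Lemma all_flatten (T : Type) (p : pred T) ss : all p (flatten ss) = all (all p) ss.
Proof. by elim: ss => //= s ss <-; rewrite all_cat. Qed.

Lemma mabs_miext n j a : mabs n (miext n j a) = mabs n a.
Proof.
rewrite !mabsE; apply: eq_big_seq => i; rewrite mem_iota => /andP[_ ltin].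
by rewrite /miext; case: Nat.eqb_spec => // ein; lia.
Qed.

Lemma mi_mabs n k : all (fun a => mabs n a == k) (mi n k).
Proof.
elim: n k => [|n IH] k; first by case: k.
rewrite miS all_flatten all_map; apply/allP => j; rewrite mem_iota => /andP[_ ltjk].
rewrite /= all_map; apply: sub_all (IH (k - j)%N) => a /= /eqP akj.
by rewrite mabsS mabs_miext akj /miext Nat.eqb_refl; apply/eqP; lia.
Qed.

Definition agree n (b a : nat -> nat) := all (fun i => b i == a i) (iota 0 n).

Lemma agreeP n b a : reflect (forall i, (i < n)%N -> b i = a i) (agree n b a).
Proof.
apply: (iffP allP) => h i; last by rewrite mem_iota => /h ->.
by move=> ltin; apply/eqP/h; rewrite mem_iota.
Qed.

Lemma agreeS n b a : agree n.+1 b a = agree n b a && (b n == a n).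
Proof. by rewrite /agree iotaSr all_rcons andbC. Qed.

Lemma agree_miext n b j a : agree n b (miext n j a) = agree n b a.
Proof.
apply/agreeP/agreeP => h i ltin; rewrite h // /miext;
by case: Nat.eqb_spec => // ein; lia.
Qed.

(** Each multi-index of degree [k] is listed exactly once. Since [b] is arbitrary from index [n] on,
    occurrences are counted up to [agree]. *)
Lemma count_mi n k b : count (agree n b) (mi n k) = (mabs n b == k).
Proof.
elim: n k => [|n IH] k; first by case: k.
rewrite miS count_flatten -map_comp sumnE big_map.
rewrite (eq_bigr (fun j => (j == b n) * (mabs n b == (k - j)%N) : nat)%N); last first.
  move=> j _ /=; rewrite count_map -IH.
  have [->|ne] := eqVneq j (b n); last first.
    rewrite mul0n; apply/eqP; rewrite -leqn0 leqNgt -has_count -all_predC.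
    apply/allP => a _ /=; rewrite agreeS negb_and; apply/orP; right.
    by rewrite /miext Nat.eqb_refl eq_sym.
  rewrite mul1n; apply: eq_count => a /=.
  by rewrite agreeS agree_miext /miext Nat.eqb_refl eqxx andbT.
have [lebk|ltkb] := leqP (b n) k; last first.
  rewrite big_seq big1 ?mabsS; first by case: eqP => //; lia.
  by move=> j; rewrite mem_iota => /andP[_ ltjk]; case: eqP => // e; lia.
rewrite (bigD1_seq (b n)) ?iota_uniq ?mem_iota ?ltnS //= eqxx mul1n.
rewrite big1 ?addn0 => [|j /negPf->]; last by rewrite mul0n.
by rewrite mabsS; congr (nat_of_bool _); apply/eqP/eqP; lia.
Qed.

Lemma mi0 n : mi n 0 = [:: fun _ => 0%N].
Proof.
elim: n => [|n IH] //; rewrite miS /= IH /=; congr [:: _].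
by apply: funext => i; rewrite /miext; case: Nat.eqb.
Qed.

Definition unit_mi (q : nat) : nat -> nat := fun i => if Nat.eqb i q then 1%N else 0%N.

Lemma mi1 n : mi n 1 = [seq unit_mi q | q <- iota 0 n].
Proof.
elim: n => [|n IH] //; rewrite iotaSr map_rcons -cats1.
rewrite miS /= cats0 IH mi0 /= -map_comp; congr (_ ++ _).
apply/eq_in_map => q; rewrite mem_iota => /andP[_ ltqn].
apply: funext => i; rewrite /miext /unit_mi /=.
by case: Nat.eqb_spec => // ->; case: Nat.eqb_spec => // e; lia.
Qed.

Lemma mabs_unit n q : (q < n)%N -> mabs n (unit_mi q) = 1%N.
Proof.
move=> ltqn; have := mi_mabs n 1; rewrite mi1 all_map => /allP /(_ q).
by rewrite mem_iota => /(_ ltqn) /eqP.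
Qed.

(** The degree of the elements of [mi n k] is passed as an [all] statement, so no membership of
    functions in a list is involved. *)
Lemma rsum_le_all (T : Type) (p : pred T) s (F G : T -> R) :
  all p s -> (forall x, p x -> F x <= G x)%RR -> (rsum s F <= rsum s G)%RR.
Proof.
move=> ps FG; elim: s ps => [|x s IH] /=; rewrite ?rsum_nil ?rsum_cons; first lra.
by move=> /andP[/FG ? /IH ?]; lra.
Qed.

Lemma eq_rsum_all (T : Type) (p : pred T) s (F G : T -> R) :
  all p s -> (forall x, p x -> F x = G x) -> rsum s F = rsum s G.
Proof.
by move=> ps FG; apply: Rle_antisym; apply: rsum_le_all ps _ => x /FG ->; lra.
Qed.

Lemma eq_sum_all (A : nmodType) (T : Type) (p : pred T) s (F G : T -> A) :
  all p s -> (forall x, p x -> F x = G x) -> \sum_(x <- s) F x = \sum_(x <- s) G x.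
Proof.
move=> ps FG; elim: s ps => [|x s IH] /=; rewrite ?big_nil ?big_cons //.
by move=> /andP[/FG -> /IH ->].
Qed.

Definition xpow (A : comNzRingType) n (x : nat -> A) (a : nat -> nat) : A :=
  \prod_(i <- iota 0 n) x i ^+ a i.

Lemma xpowS (A : comNzRingType) n (x : nat -> A) a :
  xpow n.+1 x a = xpow n x a * x n ^+ a n.
Proof. by rewrite /xpow iotaSr -cats1 big_cat /= big_seq1. Qed.

Lemma monomialE n z a : monomial n z a = xpow n z a.
Proof. by rewrite /monomial prodCE; apply: eq_bigr => i _; rewrite CpowE. Qed.

(* Used for C itself, and for polynomials with the weighted l1 norm of their
   coefficients. *)
Record ring_norm (A : comNzRingType) (emb : C -> A) (nu : A -> R) : Prop := RingNorm {
  ring_norm_ge0 : forall x : A, (0 <= nu x)%RR;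
  ring_norm0 : nu 0 = 0%RR;
  ring_norm1 : (nu 1%R <= 1)%RR;
  ring_normD : forall x y : A, (nu (x + y)%R <= nu x + nu y)%RR;
  ring_normM : forall x y : A, (nu (x * y)%R <= nu x * nu y)%RR;
  ring_norm_emb : forall c : C, (nu (emb c) <= Cnorm c)%RR }.

Section Normed.
Variables (A : comNzRingType) (emb : C -> A) (nu : A -> R).
Hypothesis nuP : ring_norm emb nu.
Let nu_ge0 := ring_norm_ge0 nuP.
Let nu0 := ring_norm0 nuP.
Let nu1 := ring_norm1 nuP.
Let nuD := ring_normD nuP.
Let nuM := ring_normM nuP.
Let nu_emb := ring_norm_emb nuP.

Lemma nu_sum (T : Type) (s : seq T) (F : T -> A) :
  (nu (\sum_(a <- s) F a)%R <= rsum s (fun a => nu (F a)))%RR.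
Proof.
elim: s => [|x s IH]; rewrite ?big_nil ?rsum_nil ?nu0 ?big_cons ?rsum_cons; first lra.
by apply: Rle_trans (nuD _ _) _; exact: Rplus_le_compat_l.
Qed.

Definition hom n (c : (nat -> nat) -> C) k (x : nat -> A) : A :=
  \sum_(a <- mi n k) emb (c a) * xpow n x a.
Definition mass n (c : (nat -> nat) -> C) k : R := rsum (mi n k) (fun a => Cnorm (c a)).
(* The terms of degree 2, ..., K + 1. *)
Definition nonlin n c K (x : nat -> A) : A := \sum_(k <- iota 2 K) hom n c k x.

(* The simultaneous size and Lipschitz bounds satisfied by degree-k monomials,
   stable under products; th stands for the ratio (distance)/(radius). *)
Definition near (rho th : R) (k : nat) (u u' : A) :=
  (nu u <= rho ^ k /\ nu u' <= rho ^ k /\ nu (u - u')%R <= INR k * rho ^ k * th)%RR.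

Section Bounds.
Variables (rho th : R).
Hypothesis rho0 : (0 <= rho)%RR.

Lemma near_one : near rho th 0 1 1.
Proof. by rewrite /near subrr nu0 /=; split; [|split] => //; lra. Qed.

(** Leibniz rule: u w - u' w' = (u - u') w + u' (w - w'), so the factors [INR k] and [INR l] in the
    Lipschitz bounds add up. *)
Lemma near_mul k l u u' w w' :
  near rho th k u u' -> near rho th l w w' -> near rho th (k + l) (u * w) (u' * w').
Proof.
move=> [u1 [u2 u3]] [w1 [w2 w3]].
have rk : (0 <= rho ^ k)%RR by exact: pow_le.
have rl : (0 <= rho ^ l)%RR by exact: pow_le.
rewrite /near Rdef_pow_add; split; [|split].
- by apply: Rle_trans (nuM _ _) _; apply: Rmult_le_compat.
- by apply: Rle_trans (nuM _ _) _; apply: Rmult_le_compat.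
have -> : u * w - u' * w' = (u - u') * w + u' * (w - w').
  by rewrite mulrBl mulrBr subrKA.
apply: Rle_trans (nuD _ _) _; rewrite plus_INR.
have -> : ((INR k + INR l) * (rho ^ k * rho ^ l) * th =
  (INR k * rho ^ k * th) * rho ^ l + rho ^ k * (INR l * rho ^ l * th))%RR by ring.
by apply: Rplus_le_compat; apply: Rle_trans (nuM _ _) _; apply: Rmult_le_compat.
Qed.

Lemma near_exp x y k : near rho th 1 x y -> near rho th k (x ^+ k) (y ^+ k).
Proof.
move=> xy; elim: k => [|k IH]; first exact: near_one.
by rewrite !exprS; exact: (@near_mul 1 k).
Qed.

Lemma near_xpow n x y a :
  (forall i, (i < n)%N -> near rho th 1 (x i) (y i)) ->
  near rho th (mabs n a) (xpow n x a) (xpow n y a).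
Proof.
elim: n => [|n IH] xy; first by rewrite /xpow !big_nil; exact: near_one.
rewrite !xpowS mabsS; apply: near_mul; last by apply: near_exp; exact: xy.
by apply: IH => i ltin; apply: xy; exact: ltnW.
Qed.
End Bounds.

Lemma hom_lip rho th n c k x y : (0 <= rho)%RR ->
  (forall i, (i < n)%N -> near rho th 1 (x i) (y i)) ->
  (nu (hom n c k x - hom n c k y)%R <= mass n c k * (INR k * rho ^ k * th))%RR.
Proof.
move=> rho0 xy; rewrite /hom -sumrB; apply: Rle_trans (nu_sum _ _) _.
rewrite Rmult_comm -rsumZ; apply: rsum_le_all (mi_mabs n k) _ => a /eqP ak.
rewrite -mulrBr; apply: Rle_trans (nuM _ _) _; rewrite Rmult_comm.
have [_ [_]] := near_xpow rho0 a xy; rewrite ak => h.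
by apply: Rmult_le_compat.
Qed.

Lemma xpow_le rho n x a : (0 <= rho)%RR ->
  (forall i, (i < n)%N -> nu (x i) <= rho)%RR -> (nu (xpow n x a) <= rho ^ mabs n a)%RR.
Proof.
move=> rho0 xr; have [i ltin|//] := @near_xpow rho 1 rho0 n x x a.
rewrite /near subrr nu0 /= !Rmult_1_r Rmult_1_l.
by split; [|split] => //; exact: xr.
Qed.

Lemma hom_le rho n c k x : (0 <= rho)%RR ->
  (forall i, (i < n)%N -> nu (x i) <= rho)%RR ->
  (nu (hom n c k x) <= mass n c k * rho ^ k)%RR.
Proof.
move=> rho0 xr; rewrite /hom; apply: Rle_trans (nu_sum _ _) _.
rewrite Rmult_comm -rsumZ; apply: rsum_le_all (mi_mabs n k) _ => a /eqP ak.
apply: Rle_trans (nuM _ _) _; rewrite Rmult_comm -ak.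
by apply: Rmult_le_compat => //; exact: xpow_le.
Qed.

(** For q <= 1/4, (K + 2) q^K <= 4 / 2^K, because each step multiplies the left side by at most 2 q
    <= 1/2. The sum of these bounds is 8 - 8 / 2^K; keeping the subtracted tail is what lets the
    induction close. *)
Lemma sum_kpow q K : (0 <= q <= / 4)%RR ->
  (rsum (iota 2 K) (fun k => INR k * q ^ k) <= q * q * (8 - 8 * (/ 2) ^ K))%RR.
Proof.
move=> q4; elim: K => [|K IH]; first by rewrite rsum_nil /=; lra.
rewrite iotaSr -cats1 rsum_cat rsum_cons rsum_nil.
have kb : (INR (2 + K)%N * q ^ K <= 4 * (/ 2) ^ K)%RR.
  elim: K {IH} => [|K IH]; first by rewrite /=; lra.
  have := pow_le q K (proj1 q4); rewrite addnS S_INR -!tech_pow_Rmult => qK.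
  have : (1 <= INR (2 + K)%N)%RR by rewrite plus_INR /=; have := pos_INR K; lra.
  move: (INR _) (q ^ K)%RR ((/ 2) ^ K)%RR IH qK => I Q H IH Q0 I1.
  have h1 : ((I + 1) * Q <= 2 * (I * Q))%RR by nra.
  have h2 : (q * ((I + 1) * Q) <= / 4 * ((I + 1) * Q))%RR.
    by apply: Rmult_le_compat_r; [nra | lra].
  have -> : ((I + 1) * (q * Q) = q * ((I + 1) * Q))%RR by ring.
  by lra.
have -> : (q ^ (2 + K)%N = q * q * q ^ K)%RR.
  by rewrite -[(2 + K)%N]/(K.+2) -!tech_pow_Rmult; ring.
by rewrite -tech_pow_Rmult; nra.
Qed.

(** The sum over k >= 2 of l Rc^k k rho^(k-1) is at most (l / rho) 8 (Rc rho)^2. The resulting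
    Lipschitz constant is O(rho) and independent of [K]: this is the source of the contraction, and
    it survives the limit in [K]. *)
Lemma nonlin_lip (l Rc rho dl : R) n c K x y :
  (forall k, mass n c k <= l * Rc ^ k)%RR ->
  (0 <= l)%RR -> (0 <= Rc)%RR -> (0 < rho)%RR -> (Rc * rho <= / 4)%RR ->
  (forall i, (i < n)%N -> nu (x i) <= rho /\ nu (y i) <= rho /\ nu (x i - y i)%R <= dl)%RR ->
  (0 <= dl)%RR ->
  (nu (nonlin n c K x - nonlin n c K y)%R <= 8 * l * Rc * Rc * rho * dl)%RR.
Proof.
move=> ml l0 Rc0 rho0 Rr4 xy dl0; rewrite /nonlin -sumrB.
have th0 : (0 <= dl / rho)%RR by apply: Rmult_le_pos => //; apply/Rlt_le/Rinv_0_lt_compat.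
have nxy i : (i < n)%N -> near rho (dl / rho) 1 (x i) (y i).
  move=> /xy[xi [yi xyi]]; rewrite /near /= !Rmult_1_r Rmult_1_l.
  by split; [|split] => //; apply: Rle_trans xyi _; apply: Req_le; field; lra.
have q0 : (0 <= Rc * rho)%RR by nra.
apply: Rle_trans (nu_sum _ _) _.
apply: (@Rle_trans _ (rsum (iota 2 K) (fun k => (l * (dl / rho)) * (INR k * (Rc * rho) ^ k)))%RR).
  apply: rsum_le => k; apply: Rle_trans (hom_lip _ _ (Rlt_le _ _ rho0) nxy) _.
  rewrite Rpow_mult_distr.
  have -> : (l * (dl / rho) * (INR k * (Rc ^ k * rho ^ k)) =
     l * Rc ^ k * (INR k * rho ^ k * (dl / rho)))%RR by ring.
  apply: Rmult_le_compat_r => //.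
  by apply: Rmult_le_pos => //; apply: Rmult_le_pos; [exact: pos_INR | apply: pow_le; lra].
rewrite rsumZ.
have := sum_kpow K (conj q0 Rr4); have := pow_le (/ 2) K ltac:(lra) => p0 s.
have lt0 : (0 <= l * (dl / rho))%RR by nra.
apply: (@Rle_trans _ (l * (dl / rho) * (Rc * rho * (Rc * rho) * 8))%RR).
  apply: Rmult_le_compat_l => //; apply: Rle_trans s _.
  by have := Rmult_le_pos _ _ (Rmult_le_pos _ _ q0 q0) p0; lra.
by apply: Req_le; field; lra.
Qed.

Lemma nonlin0 n c K : nonlin n c K (fun _ => 0) = 0.
Proof.
rewrite /nonlin big_seq big1 // => k; rewrite mem_iota => /andP[k2 _].
rewrite /hom (eq_sum_all (G := fun _ => 0) (mi_mabs n k)) ?big1 // => a /eqP ak.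
suff -> : xpow n (fun _ => 0) a = 0 :> A by rewrite mulr0.
have : (0 < mabs n a)%N by rewrite ak; exact: ltnW.
elim: n {k k2 ak} => [//|n IH]; rewrite mabsS xpowS.
case: (posnP (a n)) => [->|an0 _]; last by rewrite expr0n -(prednK an0) mulr0.
by rewrite addn0 => /IH ->; rewrite mul0r.
Qed.

(** The Lipschitz bound against the zero vector, with [dl = rho]. *)
Lemma nonlin_le (l Rc rho : R) n c K x :
  (forall k, mass n c k <= l * Rc ^ k)%RR ->
  (0 <= l)%RR -> (0 <= Rc)%RR -> (0 < rho)%RR -> (Rc * rho <= / 4)%RR ->
  (forall i, (i < n)%N -> nu (x i) <= rho)%RR ->
  (nu (nonlin n c K x) <= 8 * l * Rc * Rc * rho * rho)%RR.
Proof.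
move=> ml l0 Rc0 rho0 Rr4 xr.
rewrite -[nonlin n c K x]subr0 -(nonlin0 n c K).
apply: (nonlin_lip (n := n)) => // [i /xr xi|]; last lra.
by rewrite subr0 nu0; split => //; split; lra.
Qed.

End Normed.

(** * Power series in several variables *)

Lemma CcvB (u v : nat -> C) (l l' : C) : Ccv u l -> Ccv v l' -> Ccv (fun n => u n - v n) (l - l').
Proof.
move=> ul vl eps e0.
have [K1 h1] := ul (eps / 2)%RR ltac:(lra).
have [K2 h2] := vl (eps / 2)%RR ltac:(lra).
exists (maxn K1 K2) => n; rewrite geq_max => /andP[/h1 a /h2 b].
have -> : u n - v n - (l - l') = (u n - l) - (v n - l') by cring.
apply: Rle_lt_trans (CnormD _ _) _; rewrite CnormN; lra.
Qed.

Lemma Ccv_const (a : C) : Ccv (fun _ => a) a.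
Proof. by move=> eps e0; exists 0%N => n _; rewrite subrr Cnorm0. Qed.

Lemma Ccv_shift (u : nat -> C) (l : C) k : Ccv u l -> Ccv (fun n => u (k + n)%N) l.
Proof.
move=> ul eps /ul[K hK]; exists K => n Kn; apply: hK.
by apply: leq_trans Kn _; exact: leq_addl.
Qed.

Lemma eq_Ccv (u v : nat -> C) (l : C) : (forall n, u n = v n) -> Ccv u l -> Ccv v l.
Proof. by move=> uv ul eps /ul[K hK]; exists K => n /hK; rewrite uv. Qed.

Lemma vnorm_ge0 n x : (0 <= vnorm n x)%RR.
Proof.
by rewrite /vnorm; elim: n => [|n IH] /=; [exact: Rle_refl | apply: Rle_trans IH (Rmax_l _ _)].
Qed.

Lemma le_vnorm n x i : (i < n)%N -> (Cnorm (x i) <= vnorm n x)%RR.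
Proof.
rewrite /vnorm; elim: n => [//|n IH]; rewrite ltnS leq_eqVlt => /orP[/eqP->|/IH h] /=.
  exact: Rmax_r.
by apply: Rle_trans h (Rmax_l _ _).
Qed.

Lemma vnorm_le n x M : (0 <= M)%RR ->
  (forall i, (i < n)%N -> Cnorm (x i) <= M)%RR -> (vnorm n x <= M)%RR.
Proof.
move=> M0; rewrite /vnorm; elim: n => [|n IH] h //=; apply: Rmax_lub; last exact: h.
by apply: IH => i ltin; apply: h; exact: ltnW.
Qed.

(** Analyticity is stated separately for each component; this extracts one constant valid for all of
    them. *)
Lemma unif_bound p (Q : nat -> R -> Prop) :
  (forall j a b, Q j a -> (a <= b)%RR -> Q j b) ->
  (forall j, (j < p)%N -> exists a, Q j a) ->
  exists a, (0 <= a)%RR /\ forall j, (j < p)%N -> Q j a.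
Proof.
move=> mono; elim: p => [|p IH] h; first by exists 0%RR; split; [lra|].
have [a [a0 ha]] := IH (fun j ltjp => h j (ltnW ltjp)).
have [b hb] := h p (ltnSn p); exists (Rmax a b); split.
  by apply: Rle_trans a0 (Rmax_l _ _).
move=> j; rewrite ltnS leq_eqVlt => /orP[/eqP->|/ha qa].
  by apply: mono hb _; exact: Rmax_r.
by apply: mono qa _; exact: Rmax_l.
Qed.

(* Reals binds id to the identity of R. *)
Definition idC (x : C) : C := x.
Notation chom := (hom idC).
Notation cnonlin := (nonlin idC).

Definition coef_of (c : (nat -> nat) -> vec) j := fun a => c a j.
Definition const (c : (nat -> nat) -> C) : C := c (fun _ => 0%N).
Definition lin n (c : (nat -> nat) -> C) (x : nat -> C) : C :=
  \sum_(q <- iota 0 n) c (unit_mi q) * x q.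

(* f is the sum of the power series with coefficients c on the polydisc of radius
   r0, and the coefficients of total degree k have l1 norm at most l Rc^k. *)
Record pseries n p (f : vec -> vec) (c : (nat -> nat) -> vec) (l Rc r0 : R) : Prop := {
  ps_l0 : (0 <= l)%RR;
  ps_R0 : (0 <= Rc)%RR;
  ps_r0 : (0 < r0)%RR;
  ps_mass : forall j k, (j < p)%N -> (mass n (coef_of c j) k <= l * Rc ^ k)%RR;
  ps_val : forall z j, (forall i, (i < n)%N -> Cnorm (z i) < r0)%RR -> (j < p)%N ->
    Ccv (fun K => \sum_(k <- iota 0 K) chom n (coef_of c j) k z) (f z j) }.

Lemma CnormMle (x y : C) : (Cnorm (x * y) <= Cnorm x * Cnorm y)%RR.
Proof. by rewrite CnormM; apply: Rle_refl. Qed.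

Lemma Cnorm1le : (Cnorm 1 <= 1)%RR. Proof. by rewrite Cnorm1; lra. Qed.

Lemma Cnorm_ring_norm : ring_norm idC Cnorm.
Proof.
split; [exact: Cnorm_ge0|exact: Cnorm0|exact: Cnorm1le|exact: CnormD|exact: CnormMle|].
by move=> a; apply: Rle_refl.
Qed.

Lemma Cnorm_xpow n z a t : (0 <= t)%RR -> (forall i, (i < n)%N -> Cnorm (z i) <= t)%RR ->
  (Cnorm (xpow n z a) <= t ^ mabs n a)%RR.
Proof.
move=> t0 zt; exact: (xpow_le Cnorm_ring_norm).
Qed.

Lemma Cnorm_xpow_const n a (t : C) : Cnorm (xpow n (fun _ => t) a) = (Cnorm t ^ mabs n a)%RR.
Proof.
elim: n => [|n IH]; first by rewrite /xpow big_nil Cnorm1.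
by rewrite xpowS CnormM IH CnormX mabsS Rdef_pow_add.
Qed.

Lemma infinite_sum_ge (u : nat -> R) l k :
  (forall k, 0 <= u k)%RR -> infinite_sum u l -> (u k <= l)%RR.
Proof.
move=> u0 ul; have := @growing_ineq (fun n => sum_f_R0 u n) l.
move=> /(_ _ _ k) h; apply: Rle_trans (h _ _); last exact: ul.
  rewrite sum_f_R0E rsum_iotaS; have := rsum_ge0 (iota 0 k) u0; lra.
by move=> n /=; have := u0 n.+1; lra.
Qed.

(** Cauchy estimates by absolute convergence at the single point with all coordinates r/2: there the
    absolute degree-k part is the l1 mass of the coefficients times (r/2)^k, and it is bounded by
    the whole sum. Hence the growth rate 2/r. *)
Lemma analytic_pseries n p f : analytic0 n p f ->
  exists c l Rc r0, pseries n p f c l Rc r0.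
Proof.
move=> [c [r [r0 h]]].
pose z0 : vec := fun _ => mkC (r / 2)%RR 0.
have nz0 : Cnorm (mkC (r / 2)%RR 0) = (r / 2)%RR.
  rewrite /Cnorm /=; have -> : (r / 2 * (r / 2) + 0 * 0 = Rsqr (r / 2))%RR by rewrite /Rsqr; ring.
  by rewrite sqrt_Rsqr //; lra.
have [l [l0 hl]] : exists l, (0 <= l)%RR /\ forall j, (j < p)%N ->
    forall k, (mass n (coef_of c j) k * (r / 2) ^ k <= l)%RR.
  apply: unif_bound => [j a b qa ab k|j /ltP ltjp]; first exact: Rle_trans (qa k) ab.
  have [|[l hl] _] := h z0 _ j ltjp; first by move=> i _; rewrite nz0; lra.
  exists l => k.
  have -> : (mass n (coef_of c j) k * (r / 2) ^ k)%RR =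
     sum_deg Rplus 0%RR n k (fun a => (Cnorm (c a j) * Cnorm (monomial n z0 a))%RR).
    rewrite sum_degRE /mass Rmult_comm -rsumZ; apply: eq_rsum_all (mi_mabs n k) _.
    by move=> a /eqP ak; rewrite monomialE Cnorm_xpow_const nz0 ak Rmult_comm.
  apply: (@infinite_sum_ge (fun k => sum_deg Rplus 0%RR n k
    (fun a => (Cnorm (c a j) * Cnorm (monomial n z0 a))%RR))) hl => i.
  rewrite sum_degRE; apply: rsum_ge0 => a; apply: Rmult_le_pos; exact: Cnorm_ge0.
exists c, l, (2 / r)%RR, r; split=> //.
- by apply: Rmult_le_pos; [lra | apply/Rlt_le/Rinv_0_lt_compat].
- move=> j k /hl/(_ k) hk.
  have p0 : (0 < (r / 2) ^ k)%RR by apply: pow_lt; lra.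
  apply: (Rmult_le_reg_r _ _ _ p0); apply: Rle_trans hk _.
  rewrite Rmult_assoc -Rpow_mult_distr.
  have -> : (2 / r * (r / 2) = 1)%RR by field; lra.
  by rewrite pow1; lra.
move=> z j zr /ltP ltjp.
have [|_] := h z _ j ltjp; first by move=> i /ltP; exact: zr.
move/CseriesP; apply: eq_Ccv => K; apply: eq_bigr => k _.
by rewrite sum_degCE; apply: eq_bigr => a _; rewrite monomialE.
Qed.

Lemma geo_sum (q : R) m K : (0 <= q <= / 2)%RR ->
  (rsum (iota m K) (fun k => q ^ k) <= q ^ m * (2 - 2 * (/ 2) ^ K))%RR.
Proof.
move=> q2; elim: K => [|K IH]; first by rewrite rsum_nil /=; lra.
rewrite iotaSr -cats1 rsum_cat rsum_cons rsum_nil Rdef_pow_add -tech_pow_Rmult.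
have qm := pow_le q m (proj1 q2).
have : (q ^ K <= (/ 2) ^ K)%RR by apply: pow_incr.
by move: IH; set h := ((/ 2) ^ K)%RR; nra.
Qed.

Lemma hom_tail n (c : (nat -> nat) -> C) l Rc rho m K (x : vec) :
  (0 <= l)%RR -> (0 <= Rc)%RR -> (forall k, mass n c k <= l * Rc ^ k)%RR ->
  (0 <= rho)%RR -> (Rc * rho <= / 2)%RR ->
  (forall i, (i < n)%N -> Cnorm (x i) <= rho)%RR ->
  (rsum (iota m K) (fun k => mass n c k * rho ^ k) <= l * ((Rc * rho) ^ m * 2))%RR /\
  (Cnorm (\sum_(k <- iota m K) chom n c k x) <= l * ((Rc * rho) ^ m * 2))%RR.
Proof.
move=> l0 Rc0 ml rho0 Rr xr.
have q0 : (0 <= Rc * rho)%RR by apply: Rmult_le_pos.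
have b : (rsum (iota m K) (fun k => mass n c k * rho ^ k) <= l * ((Rc * rho) ^ m * 2))%RR.
  apply: (@Rle_trans _ (rsum (iota m K) (fun k => l * (Rc * rho) ^ k))%RR).
    apply: rsum_le => k; rewrite Rpow_mult_distr -Rmult_assoc.
    by apply: Rmult_le_compat_r; [exact: pow_le | exact: ml].
  rewrite rsumZ; apply: Rmult_le_compat_l => //.
  apply: Rle_trans (geo_sum m K (conj q0 Rr)) _.
  apply: Rmult_le_compat_l; first exact: pow_le.
  by have := pow_le (/ 2) K ltac:(lra); lra.
split=> //; apply: Rle_trans b; apply: Rle_trans (Cnorm_sum _ _) _.
apply: rsum_le => k; exact: (hom_le Cnorm_ring_norm).
Qed.

Section PSeries.
Variables (n p : nat) (f : vec -> vec) (c : (nat -> nat) -> vec) (l Rc r0 : R).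
Hypothesis ps : pseries n p f c l Rc r0.
Let l0 := ps_l0 ps.
Let Rc0 := ps_R0 ps.

Lemma hom_0 c0 (x : vec) : chom n c0 0 x = const c0.
Proof.
rewrite /hom mi0 big_seq1 /xpow big1 ?mulr1 // => i _; exact: expr0.
Qed.

Lemma xpow_unit (x : vec) q : (q < n)%N -> xpow n x (unit_mi q) = x q.
Proof.
move=> ltqn; rewrite /xpow (bigD1_seq q) ?iota_uniq ?mem_iota //=.
rewrite /unit_mi Nat.eqb_refl expr1 big1 ?mulr1 // => i /eqP iq.
by case: Nat.eqb_spec => // _; rewrite expr0.
Qed.

Lemma hom_1 c0 (x : vec) : chom n c0 1 x = lin n c0 x.
Proof.
rewrite /hom mi1 big_map /lin; apply: eq_big_seq => q.
by rewrite mem_iota => /andP[_ ltqn]; rewrite xpow_unit.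
Qed.

Lemma partial_sum c0 K (x : vec) :
  \sum_(k <- iota 0 (2 + K)) chom n c0 k x = const c0 + lin n c0 x + cnonlin n c0 K x.
Proof.
by rewrite iotaD big_cat /= big_cons big_seq1 hom_0 hom_1.
Qed.

Lemma ps_nonlin z j : (forall i, (i < n)%N -> Cnorm (z i) < r0)%RR -> (j < p)%N ->
  Ccv (fun K => cnonlin n (coef_of c j) K z)
    (f z j - (const (coef_of c j) + lin n (coef_of c j) z)).
Proof.
move=> zr ltjp; have := CcvB (Ccv_shift 2 (ps_val ps zr ltjp))
  (Ccv_const (const (coef_of c j) + lin n (coef_of c j) z)).
by apply: eq_Ccv => K; rewrite partial_sum addrC addKr.
Qed.

Lemma lin0 c0 : lin n c0 vzero = 0.
Proof. by rewrite /lin big1 // => q _; rewrite mulr0. Qed.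

Lemma linB c0 (x y : vec) : lin n c0 x - lin n c0 y = lin n c0 (vsub x y).
Proof.
rewrite /lin -sumrB; apply: eq_bigr => q _; rewrite -mulrBr; congr (_ * _).
Qed.

Lemma cnonlin_lip j K rho dl (x y : vec) : (j < p)%N ->
  (0 < rho)%RR -> (Rc * rho <= / 4)%RR ->
  (forall i, (i < n)%N -> Cnorm (x i) <= rho /\ Cnorm (y i) <= rho /\ Cnorm (x i - y i) <= dl)%RR ->
  (0 <= dl)%RR ->
  (Cnorm (cnonlin n (coef_of c j) K x - cnonlin n (coef_of c j) K y)
     <= 8 * l * Rc * Rc * rho * dl)%RR.
Proof.
move=> ltjp rho0 Rr4 xy dl0.
apply: (nonlin_lip Cnorm_ring_norm) => // k; exact: (ps_mass ps).
Qed.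

(** The bound of [cnonlin_lip] does not depend on the truncation, so it holds in the limit. With
    [y = 0] and [rho = dl = |x|] it is the quadratic remainder estimate that yields the derivative
    at 0. *)
Lemma ps_lip j rho dl (x y : vec) : (j < p)%N ->
  (0 < rho < r0)%RR -> (Rc * rho <= / 4)%RR ->
  (forall i, (i < n)%N -> Cnorm (x i) <= rho /\ Cnorm (y i) <= rho /\ Cnorm (x i - y i) <= dl)%RR ->
  (0 <= dl)%RR ->
  (Cnorm (f x j - f y j - lin n (coef_of c j) (vsub x y)) <= 8 * l * Rc * Rc * rho * dl)%RR.
Proof.
move=> ltjp [rho0 rhor] Rr4 xy dl0.
have xr i : (i < n)%N -> (Cnorm (x i) < r0)%RR by move=> /xy; lra.
have yr i : (i < n)%N -> (Cnorm (y i) < r0)%RR by move=> /xy; lra.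
have cv := CcvB (ps_nonlin xr ltjp) (ps_nonlin yr ltjp).
have := Ccv_le (v := 0) cv; rewrite subr0 -linB => h.
have -> : f x j - f y j - (lin n (coef_of c j) x - lin n (coef_of c j) y) =
  f x j - (const (coef_of c j) + lin n (coef_of c j) x) -
  (f y j - (const (coef_of c j) + lin n (coef_of c j) y)) by cring.
apply: h; exists 0%N => K _; rewrite subr0; exact: cnonlin_lip.
Qed.

Lemma ps_zero j : (j < p)%N -> f vzero j = const (coef_of c j).
Proof.
move=> ltjp.
have zr i : (i < n)%N -> (Cnorm (vzero i) < r0)%RR.
  by rewrite /vzero C0E Cnorm0 => _; exact: (ps_r0 ps).
have := ps_nonlin zr ltjp; rewrite lin0 addr0 => h.
apply/subr0_eq; apply: Ccv_unique h _.
apply: eq_Ccv (Ccv_const 0) => K; symmetry; exact: nonlin0.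
Qed.

Lemma ps_tail j m rho (x : vec) : (j < p)%N ->
  (0 <= rho < r0)%RR -> (Rc * rho <= / 2)%RR ->
  (forall i, (i < n)%N -> Cnorm (x i) <= rho)%RR ->
  (Cnorm (f x j - \sum_(k <- iota 0 m) chom n (coef_of c j) k x) <=
     2 * l * Rc ^ m * rho ^ m)%RR.
Proof.
move=> ltjp [rho0 rhor] Rr2 xr.
have xr0 i : (i < n)%N -> (Cnorm (x i) < r0)%RR by move=> /xr; lra.
apply: Ccv_le (Ccv_shift m (ps_val ps xr0 ltjp)) _; exists 0%N => K _.
rewrite iotaD big_cat /= addrAC subrr add0r add0n.
have [_ h] := hom_tail m K l0 Rc0 (fun k => ps_mass ps k ltjp) rho0 Rr2 xr.
by apply: Rle_trans h _; rewrite Rpow_mult_distr; apply: Req_le; ring.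
Qed.

Lemma exists_rho : exists rho, (0 < rho < r0)%RR /\ (Rc * rho <= / 4)%RR.
Proof.
have r00 := ps_r0 ps; exists (Rmin (r0 / 2) (/ (4 * (Rc + 1))))%RR.
have i0 : (0 < / (4 * (Rc + 1)))%RR by apply: Rinv_0_lt_compat; lra.
have m0 : (0 < Rmin (r0 / 2) (/ (4 * (Rc + 1))))%RR by apply: Rmin_glb_lt; lra.
split; first by have := Rmin_l (r0 / 2) (/ (4 * (Rc + 1))); lra.
have le2 := Rmin_r (r0 / 2) (/ (4 * (Rc + 1))).
apply: (@Rle_trans _ ((Rc + 1) * / (4 * (Rc + 1))))%RR; last by apply: Req_le; field; lra.
by apply: Rmult_le_compat; lra.
Qed.

Lemma ps_deriv L : (forall j q, (j < p)%N -> (q < n)%N -> L j q = c (unit_mi q) j) ->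
  has_deriv0 n p f L.
Proof.
move=> Lc eps e0; have [rho [[rho0 rhor] Rr]] := exists_rho.
pose A := (8 * l * Rc * Rc + 1)%RR.
have A0 : (0 < A)%RR by rewrite /A; have := Rmult_le_pos _ _ (Rmult_le_pos _ _ l0 Rc0) Rc0; lra.
exists (Rmin rho (eps / A)); split.
  by apply: Rmin_glb_lt => //; apply: Rmult_lt_0_compat => //; exact: Rinv_0_lt_compat.
move=> h hd; have h0 := vnorm_ge0 n h.
have hr : (vnorm n h < rho)%RR by apply: Rlt_le_trans hd (Rmin_l _ _).
have he : (vnorm n h < eps / A)%RR by apply: Rlt_le_trans hd (Rmin_r _ _).
apply: vnorm_le => [|j ltjp]; first by apply: Rmult_le_pos => //; lra.
have lE : matvec n L h j = lin n (coef_of c j) h.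
  rewrite /matvec sumCE; apply: eq_big_seq => q; rewrite mem_iota => /andP[_ ltqn].
  by rewrite Lc.
have -> : vsub (vsub (f h) (f vzero)) (matvec n L h) j =
  f h j - f vzero j - lin n (coef_of c j) (vsub h vzero).
  rewrite -linB lin0 subr0 /vsub lE //.
(* [ps_lip] needs a positive radius, and the radius used below is |h| itself; the case h = 0 is
   therefore treated with the fixed radius [rho] and [dl = 0]. *)
have [hz|hz] := Req_dec (vnorm n h) 0.
  have b := ps_lip (rho := rho) (dl := 0%RR) (x := h) (y := vzero) ltjp (conj rho0 rhor) Rr.
  apply: Rle_trans (b _ (Rle_refl _)) _; last by rewrite hz; lra.
  move=> i ltin; have := le_vnorm h ltin; rewrite hz => hi0.
  by rewrite /vzero subr0 Cnorm0; lra.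
have b := ps_lip (rho := vnorm n h) (dl := vnorm n h) (x := h) (y := vzero) ltjp.
apply: Rle_trans (b _ _ _ h0) _; first by lra.
- by apply: Rle_trans Rr; apply: Rmult_le_compat_l; lra.
- move=> i ltin; have := le_vnorm h ltin.
  by rewrite /vzero subr0 Cnorm0; lra.
apply: Rmult_le_compat_r => //.
have -> : (eps = A * (eps / A))%RR by field; lra.
apply: Rmult_le_compat; try lra.
  by have := Rmult_le_pos _ _ (Rmult_le_pos _ _ l0 Rc0) Rc0; lra.
by rewrite /A; lra.
Qed.

End PSeries.

(** * Reading linear coefficients off a derivative *)

Definition axis (q : nat) (s : R) : vec := fun i => if i == q then mkC s 0 else C0.

Lemma Cnorm_real s : (0 <= s)%RR -> Cnorm (mkC s 0) = s.
Proof.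
move=> s0; rewrite /Cnorm /=; have -> : (s * s + 0 * 0 = Rsqr s)%RR by rewrite /Rsqr; ring.
exact: sqrt_Rsqr.
Qed.

Lemma Cnorm_axis q s i : (0 <= s)%RR -> (Cnorm (axis q s i) <= s)%RR.
Proof.
move=> s0; rewrite /axis; case: ifP => _; last by rewrite C0E Cnorm0.
by rewrite Cnorm_real //; lra.
Qed.

Lemma sum_axis n q s (F : nat -> C) : (q < n)%N ->
  \sum_(i <- iota 0 n) F i * axis q s i = F q * mkC s 0.
Proof.
move=> ltqn; rewrite (bigD1_seq q) ?iota_uniq ?mem_iota //= /axis eqxx.
by rewrite big1 ?addr0 // => i /negPf ->; rewrite C0E mulr0.
Qed.

(** Small real points on one axis already determine a column of the derivative. The expansion is a
    hypothesis on [g], so that the lemma also covers the restriction of Z to one block, where the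
    coefficient sits at a shifted index. *)
Lemma deriv_coef n p g L q j (w : C) A s0 :
  has_deriv0 n p g L -> (q < n)%N -> (j < p)%N -> (0 < s0)%RR ->
  (forall s, 0 < s < s0 -> Cnorm (g (axis q s) j - g vzero j - (w * mkC s 0)) <= A * s * s)%RR ->
  L j q = w.
Proof.
move=> dg ltqn ltjp s00 gw; apply/subr0_eq/Cnorm_eq0; apply: Rle_antisym; last exact: Cnorm_ge0.
apply: Rle_eps => eps e0.
have [dl [dl0 hd]] := dg (eps / 2)%RR ltac:(lra).
pose A' := (Rabs A + 1)%RR.
have A'0 : (0 < A')%RR by rewrite /A'; have := Rabs_pos A; lra.
(* The three bounds put the point within reach of the derivative, within reach of the expansion, and
   make the quadratic error at most (eps/2) s. *)
pose s := (Rmin (Rmin (dl / 2) (s0 / 2)) (eps / 2 / A'))%RR.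
have ea : (0 < eps / 2 / A')%RR by apply: Rmult_lt_0_compat; [lra|exact: Rinv_0_lt_compat].
have sp : (0 < s)%RR by apply: Rmin_glb_lt => //; apply: Rmin_glb_lt; lra.
have s1 : (s <= dl / 2)%RR by apply: Rle_trans (Rmin_l _ _) (Rmin_l _ _).
have s2 : (s <= s0 / 2)%RR by apply: Rle_trans (Rmin_l _ _) (Rmin_r _ _).
have s3 : (s <= eps / 2 / A')%RR by apply: Rmin_r.
have vs : (vnorm n (axis q s) <= s)%RR.
  by apply: vnorm_le => [|i _]; [lra|apply: Cnorm_axis; lra].
have h1 := hd (axis q s) ltac:(lra).
have h2 := gw s ltac:(lra).
have h3 := Rle_trans _ _ _ (le_vnorm (n := p) _ ltjp) h1.
have e : vsub (vsub (g (axis q s)) (g vzero)) (matvec n L (axis q s)) j =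
   g (axis q s) j - g vzero j - L j q * mkC s 0.
  by rewrite /vsub /matvec sumCE; congr (_ - _); exact: (sum_axis s (L j)).
rewrite e in h3.
have h4 : (Cnorm (L j q - w) * s <= eps * s)%RR.
  rewrite -{1}(Cnorm_real (Rlt_le _ _ sp)) -CnormM.
  have -> : (L j q - w) * mkC s 0 = (g (axis q s) j - g vzero j - w * mkC s 0) -
    (g (axis q s) j - g vzero j - L j q * mkC s 0) by cring.
  apply: Rle_trans (CnormD _ _) _; rewrite CnormN.
  have : (A * s * s <= eps / 2 * s)%RR.
    apply: Rmult_le_compat_r; first lra.
    apply: (@Rle_trans _ (A' * s)%RR).
      by apply: Rmult_le_compat_r; [lra|rewrite /A'; have := Rle_abs A; lra].
    apply: (@Rle_trans _ (A' * (eps / 2 / A'))%RR); last by apply: Req_le; field; lra.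
    by apply: Rmult_le_compat_l; lra.
  by have : (eps / 2 * vnorm n (axis q s) <= eps / 2 * s)%RR by [apply: Rmult_le_compat_l; lra]; lra.
by apply: Rle_trans (Rmult_le_reg_r _ _ _ sp h4) _; lra.
Qed.

Lemma ps_deriv_coef n p f c l Rc r0 L q j : pseries n p f c l Rc r0 ->
  has_deriv0 n p f L -> (q < n)%N -> (j < p)%N -> L j q = c (unit_mi q) j.
Proof.
move=> ps df ltqn ltjp; have [rho [[rho0 rhor] Rr]] := exists_rho ps.
have h := deriv_coef (A := (8 * l * Rc * Rc)%RR) (w := c (unit_mi q) j) df ltqn ltjp rho0.
apply: h => s [sp srho].
have -> : c (unit_mi q) j * mkC s 0 = lin n (coef_of c j) (vsub (axis q s) vzero).
  by rewrite -linB lin0 subr0 /lin (sum_axis s (fun i => coef_of c j (unit_mi i)) ltqn).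
have R0 := ps_R0 ps; apply: (ps_lip ps) => //; try lra.
  by apply: Rle_trans Rr; apply: Rmult_le_compat_l; lra.
move=> i _; rewrite /vzero subr0 Cnorm0; have := @Cnorm_axis q s i; lra.
Qed.

(** * The weighted l1 norm of a polynomial *)

Section PolyNorm.
Variable n : nat.
Implicit Types (p q : {mpoly C[n]}) (a b : 'X_{1..n}).

Definition pnorm (t : R) p : R := rsum (msupp p) (fun a => Cnorm p@_a * t ^ mdeg a)%RR.

(** Lets polynomials with different supports be compared by summing over one common duplicate-free
    list. *)
Lemma rsum_msupp p (s : seq 'X_{1..n}) (F : 'X_{1..n} -> R) : uniq s ->
  {subset msupp p <= s} -> (forall a, p@_a = 0 -> F a = 0%RR) ->
  rsum s F = rsum (msupp p) F.
Proof.
move=> us sub F0; rewrite /rsum (bigID (mem (msupp p))) /= [X in Rplus _ X]big1; last first.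
  by move=> a /memN_msupp_eq0 /F0.
rewrite Rplus_0_r -big_filter; apply: perm_big; apply: uniq_perm.
- exact: filter_uniq.
- exact: msupp_uniq.
by move=> a; rewrite mem_filter; apply/andP/idP => [[]//|h]; split=> //; exact: sub.
Qed.

Lemma sum_msupp p (A : nmodType) (s : seq 'X_{1..n}) (F : 'X_{1..n} -> A) : uniq s ->
  {subset msupp p <= s} -> (forall a, p@_a = 0 -> F a = 0) ->
  \sum_(a <- s) F a = \sum_(a <- msupp p) F a.
Proof.
move=> us sub F0; rewrite (bigID (mem (msupp p))) /= [X in _ + X]big1 ?addr0; last first.
  by move=> a /memN_msupp_eq0 /F0.
rewrite -big_filter; apply: perm_big; apply: uniq_perm.
- exact: filter_uniq.
- exact: msupp_uniq.
by move=> a; rewrite mem_filter; apply/andP/idP => [[]//|h]; split=> //; exact: sub.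
Qed.

Lemma term0 t p a : p@_a = 0 -> (Cnorm p@_a * t ^ mdeg a)%RR = 0%RR.
Proof. by move=> ->; rewrite Cnorm0 Rmult_0_l. Qed.

Lemma pnormE t p s : uniq s -> {subset msupp p <= s} ->
  pnorm t p = rsum s (fun a => Cnorm p@_a * t ^ mdeg a)%RR.
Proof.
by move=> us sub; symmetry; apply: rsum_msupp => // a; exact: term0.
Qed.

Section T.
Variable t : R.
Hypothesis t0 : (0 <= t)%RR.

Lemma term_ge0 p a : (0 <= Cnorm p@_a * t ^ mdeg a)%RR.
Proof. by apply: Rmult_le_pos; [exact: Cnorm_ge0|exact: pow_le]. Qed.

Lemma pnorm_ge0 p : (0 <= pnorm t p)%RR.
Proof. by apply: rsum_ge0 => a; exact: term_ge0. Qed.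

Lemma pnorm0 : pnorm t 0 = 0%RR.
Proof. by rewrite /pnorm msupp0 rsum_nil. Qed.

(** Used with a single monomial to bound one coefficient, and with [flat] to bound all coefficients
    below a given degree. *)
Lemma pnorm_uniq p s : uniq s -> (rsum s (fun a => Cnorm p@_a * t ^ mdeg a) <= pnorm t p)%RR.
Proof.
move=> us; pose s' := undup (msupp p ++ s).
have us' : uniq s' by exact: undup_uniq.
rewrite (pnormE t us') => [|a h]; last by rewrite mem_undup mem_cat h.
have -> : rsum s' (fun a => Cnorm p@_a * t ^ mdeg a)%RR =
  (rsum (s ++ [seq a <- s' | a \notin s]) (fun a => Cnorm p@_a * t ^ mdeg a))%RR.
  apply: perm_big; apply: uniq_perm => //.
    rewrite cat_uniq us filter_uniq // andbT /=.
    by apply/hasPn => a; rewrite mem_filter => /andP[].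
  move=> a; rewrite mem_cat mem_filter mem_undup mem_cat.
  by case: (a \in s); rewrite ?orbT ?orbF.
rewrite rsum_cat.
have := rsum_ge0 [seq a <- s' | a \notin s] (fun a => term_ge0 p a); lra.
Qed.

Lemma pnormD p q : (pnorm t (p + q) <= pnorm t p + pnorm t q)%RR.
Proof.
pose s := undup (msupp p ++ msupp q ++ msupp (p + q)).
have us : uniq s by exact: undup_uniq.
rewrite !(pnormE t us) => [|a h|a h|a h]; try by rewrite mem_undup !mem_cat h ?orbT.
rewrite -rsumD; apply: rsum_le => a; rewrite mcoeffD -Rmult_plus_distr_r.
by apply: Rmult_le_compat_r; [exact: pow_le|exact: CnormD].
Qed.

Lemma pnorm_sum (T : Type) (s : seq T) (F : T -> {mpoly C[n]}) :
  (pnorm t (\sum_(x <- s) F x) <= rsum s (fun x => pnorm t (F x)))%RR.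
Proof.
elim: s => [|x s IH]; rewrite ?big_nil ?rsum_nil ?pnorm0 ?big_cons ?rsum_cons; first lra.
by apply: Rle_trans (pnormD _ _) _; exact: Rplus_le_compat_l.
Qed.

Lemma pnormZX (c : C) a : (pnorm t (c *: 'X_[a]) <= Cnorm c * t ^ mdeg a)%RR.
Proof.
rewrite (@pnormE t _ [:: a]) // => [|b].
  rewrite rsum_cons rsum_nil mcoeffZ mcoeffX eqxx mulr1; lra.
rewrite mcoeff_msupp mcoeffZ mcoeffX inE; case: (a =P b) => [->|_] //.
by rewrite mulr0 eqxx.
Qed.

Lemma pnormM p q : (pnorm t (p * q) <= pnorm t p * pnorm t q)%RR.
Proof.
rewrite {1}(mpolyE p) {1}(mpolyE q) big_distrlr /=.
apply: Rle_trans (pnorm_sum _ _) _.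
rewrite {1}/pnorm Rmult_comm -rsumZ; apply: rsum_le => a.
apply: Rle_trans (pnorm_sum _ _) _.
rewrite {1}/pnorm Rmult_comm -rsumZ; apply: rsum_le => b.
rewrite -scalerAl -scalerAr scalerA -mpolyXD; apply: Rle_trans (pnormZX _ _) _.
by rewrite CnormM mdegD Rdef_pow_add; apply: Req_le; ring.
Qed.

Lemma pnormC (c : C) : (pnorm t c%:MP <= Cnorm c)%RR.
Proof.
have -> : c%:MP = c *: 'X_[0%MM] :> {mpoly C[n]} by rewrite mpolyX0 -mul_mpolyC mulr1.
by apply: Rle_trans (pnormZX _ _) _; rewrite mdeg0 /=; lra.
Qed.

Lemma pnorm1 : (pnorm t 1 <= 1)%RR.
Proof. by apply: Rle_trans (pnormC 1) _; rewrite Cnorm1; lra. Qed.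

Lemma pnorm_ring_norm : ring_norm (fun c : C => c%:MP : {mpoly C[n]}) (pnorm t).
Proof. by split; [exact: pnorm_ge0|exact: pnorm0|exact: pnorm1|exact: pnormD|exact: pnormM|exact: pnormC]. Qed.

Lemma pnormN p : pnorm t (- p) = pnorm t p.
Proof.
rewrite (@pnormE t (- p) (msupp p)) ?msupp_uniq // => [|a].
  by apply: eq_rsum => a; rewrite mcoeffN CnormN.
by rewrite !mcoeff_msupp mcoeffN oppr_eq0.
Qed.

Lemma meval_le (z : vec) p : (forall i, (i < n)%N -> Cnorm (z i) <= t)%RR ->
  (Cnorm p.@[fun i : 'I_n => z i] <= pnorm t p)%RR.
Proof.
move=> zt; rewrite mevalE; apply: Rle_trans (Cnorm_sum _ _) _.
apply: rsum_le => a; rewrite CnormM; apply: Rmult_le_compat_l; first exact: Cnorm_ge0.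
rewrite mdegE; elim/big_rec2: _ => [|i y x _ xy]; first by rewrite Cnorm1 /=; lra.
rewrite CnormM CnormX Rdef_pow_add; apply: Rmult_le_compat => //; try exact: Cnorm_ge0.
  by apply: pow_le; exact: Cnorm_ge0.
by apply: pow_incr; split; [exact: Cnorm_ge0|exact: zt].
Qed.
End T.

(** Coefficient multipliers: the substitution z |-> Lambda^k z, the entries of the linearized
    operator and those of its inverse all have this form. *)
Definition diag (g : 'X_{1..n} -> C) p : {mpoly C[n]} :=
  \sum_(a <- msupp p) (g a * p@_a) *: 'X_[a].

Lemma mcoeff_diag g p a : (diag g p)@_a = g a * p@_a.
Proof.
rewrite /diag raddf_sum /=.
have -> : \sum_(b <- msupp p) ((g b * p@_b) *: 'X_[b])@_a =
   \sum_(b <- msupp p) (if b == a then g a * p@_a else 0).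
  apply: eq_bigr => b _; rewrite mcoeffZ mcoeffX.
  by case: eqP => [->|_]; rewrite ?mulr1 ?mulr0.
have [ap|/memN_msupp_eq0 pa0] := boolP (a \in msupp p).
  by rewrite (bigD1_seq a) ?msupp_uniq //= eqxx big1 ?addr0 // => b /negPf->.
by rewrite pa0 mulr0 big1 // => b _; case: ifP.
Qed.

Lemma pnorm_diag t g p G : (0 <= t)%RR -> (forall a, Cnorm (g a) <= G)%RR ->
  (pnorm t (diag g p) <= G * pnorm t p)%RR.
Proof.
move=> t0 gG; rewrite (@pnormE t (diag g p) (msupp p)) ?msupp_uniq // => [|a].
  rewrite /pnorm -rsumZ; apply: rsum_le => a; rewrite mcoeff_diag CnormM Rmult_assoc.
  by apply: Rmult_le_compat_r => //; exact: term_ge0.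
by rewrite !mcoeff_msupp mcoeff_diag; apply: contra => /eqP ->; rewrite mulr0.
Qed.

Lemma diagB g p q : diag g (p - q) = diag g p - diag g q.
Proof. by apply/mpolyP => a; rewrite mcoeffB !mcoeff_diag mcoeffB mulrBr. Qed.

Definition mnm (a : nat -> nat) : 'X_{1..n} := [multinom a i | i < n].
Definition ext (a : 'X_{1..n}) : nat -> nat := fun i => nth 0%N a i.

Lemma extE a (i : 'I_n) : ext a i = a i.
Proof. by rewrite /ext (mnm_nth 0%N). Qed.

Lemma ext_mnm (a : nat -> nat) i : (i < n)%N -> ext (mnm a) i = a i.
Proof. by move=> ltin; rewrite (extE _ (Ordinal ltin)) mnmE. Qed.

Lemma mnm_ext a : mnm (ext a) = a.
Proof. by apply/mnmP => i; rewrite mnmE extE. Qed.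

Lemma big_iota_ord (T : Type) (x0 : T) (op : Monoid.law x0) (F : nat -> T) :
  \big[op/x0]_(i <- iota 0 n) F i = \big[op/x0]_(i < n) F i.
Proof. by rewrite -(big_mkord xpredT) /index_iota subn0. Qed.

Lemma mabs_mnm (a : nat -> nat) : mdeg (mnm a) = mabs n a.
Proof. by rewrite mabsE big_iota_ord mdegE; apply: eq_bigr => i _; rewrite mnmE. Qed.

Lemma mabs_ext a : mabs n (ext a) = mdeg a.
Proof. by rewrite -mabs_mnm mnm_ext. Qed.

Lemma xpow_ext (A : comNzRingType) (x : nat -> A) a : xpow n x (ext a) = \prod_(i < n) x i ^+ a i.
Proof. by rewrite /xpow big_iota_ord; apply: eq_bigr => i _; rewrite extE. Qed.

Lemma xpow_mnm (A : comNzRingType) (x : nat -> A) (a : nat -> nat) :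
  xpow n x (ext (mnm a)) = xpow n x a.
Proof. by rewrite xpow_ext /xpow big_iota_ord; apply: eq_bigr => i _; rewrite mnmE. Qed.

Lemma mnm_unit i : (i < n)%N -> mdeg (mnm (unit_mi i)) = 1%N.
Proof. by move=> ltin; rewrite mabs_mnm mabs_unit. Qed.

Lemma agree_mnm (a : nat -> nat) b : agree n (ext b) a = (mnm a == b).
Proof.
apply/agreeP/eqP => [h|<- i ltin]; last by rewrite ext_mnm.
by apply/mnmP => i; rewrite mnmE -extE h.
Qed.

Definition flat K : seq 'X_{1..n} := flatten [seq map mnm (mi n k) | k <- iota 0 K].

(** Membership in [flat K] and absence of repetitions are both read off from this count. *)
Lemma count_flat K a : count_mem a (flat K) = (mdeg a < K)%N.
Proof.
rewrite /flat count_flatten -map_comp sumnE big_map.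
rewrite (eq_bigr (fun k => (mdeg a == k) : nat)); last first.
  move=> k _ /=; rewrite count_map -mabs_ext -count_mi; apply: eq_count => b /=.
  by rewrite agree_mnm.
have [ltaK|leKa] := ltnP (mdeg a) K.
  rewrite (bigD1_seq (mdeg a)) ?iota_uniq ?mem_iota //= eqxx big1 ?addn0 // => i.
  by rewrite eq_sym => /negPf ->.
rewrite big_seq big1 // => i; rewrite mem_iota => /andP[_ ltiK].
by case: eqP => // e; lia.
Qed.

Lemma mem_flat K a : (a \in flat K) = (mdeg a < K)%N.
Proof. by rewrite -has_pred1 has_count count_flat lt0b. Qed.

Lemma flat_uniq K : uniq (flat K).
Proof.
by apply: count_mem_uniq => a; rewrite mem_flat count_flat.
Qed.

Lemma rsum_flat K F :
  rsum (flat K) F = rsum (iota 0 K) (fun k => rsum (mi n k) (fun x => F (mnm x))).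
Proof.
rewrite /flat /rsum big_flatten big_map; apply: eq_bigr => k _.
by rewrite big_map.
Qed.

Lemma sum_flat (A : nmodType) K (F : 'X_{1..n} -> A) :
  \sum_(a <- flat K) F a = \sum_(k <- iota 0 K) \sum_(x <- mi n k) F (mnm x).
Proof.
by rewrite /flat big_flatten big_map; apply: eq_bigr => k _; rewrite big_map.
Qed.

Lemma meval_hom p K (z : vec) : (msize p <= K)%N ->
  p.@[fun i : 'I_n => z i] =
  \sum_(k <- iota 0 K) hom idC n (fun x => p@_(mnm x)) k z.
Proof.
move=> sK; rewrite mevalE.
rewrite -(sum_msupp (p := p) (flat_uniq K)).
- rewrite sum_flat; apply: eq_bigr => k _; apply: eq_bigr => a _.
  by rewrite -xpow_ext xpow_mnm.
- by move=> a /msize_mdeg_lt h; rewrite mem_flat; exact: leq_trans sK.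
by move=> a ->; rewrite mul0r.
Qed.

End PolyNorm.

(** * Invertibility of T *)

Definition to_mx d (A : mat) : 'M[C]_d := \matrix_(i < d, j < d) A i j.
Definition of_mx d (M : 'M[C]_d) : mat := fun i j =>
  if insub i is Some i' then if insub j is Some j' then M i' j' else 0 else 0.

Lemma of_mxE d (M : 'M[C]_d) (i j : 'I_d) : of_mx M i j = M i j.
Proof. by rewrite /of_mx !valK. Qed.

(** [det] is by definition the Laplace expansion along the first row, so it is matched with
    [expand_det_row] at [ord0]; the index shift in [minor] is [bump]. *)
Lemma det_to_mx d (A : mat) : det d A = \det (to_mx d A).
Proof.
elim: d A => [|d IH] A; first by rewrite det_mx00.
transitivity (\sum_(j <- iota 0 d.+1)
    (if Nat.even j then C1 else Copp C1) * (A 0%N j * det d (minor A j))).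
  by rewrite -sumCE.
rewrite (expand_det_row _ ord0) big_iota_ord.
apply: eq_bigr => j _; rewrite mxE /cofactor IH add0n mulrCA; congr (_ * _).
have -> : to_mx d (minor A j) = row' ord0 (col' j (to_mx d.+1 A)).
  apply/matrixP => i k; rewrite !mxE /minor; congr (A _ _).
  by rewrite /= /bump; case: Nat.ltb_spec; lia.
congr (_ * _).
rewrite -signr_odd; have -> : Nat.even j = ~~ odd j.
    by elim: (nat_of_ord j) => // k IHk; rewrite Nat.even_succ -Nat.negb_even IHk.
by case: (odd j).
Qed.

Lemma inv_exists d (A : mat) : det d A <> 0 -> exists S : mat,
  (forall i k, (i < d)%N -> (k < d)%N -> \sum_(j <- iota 0 d) A i j * S j k = (i == k)%:R) /\
  (forall i k, (i < d)%N -> (k < d)%N -> \sum_(j <- iota 0 d) S i j * A j k = (i == k)%:R).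
Proof.
rewrite det_to_mx => /eqP detA; exists (of_mx (invmx (to_mx d A))).
have uA : to_mx d A \in unitmx by rewrite unitmxE unitfE.
split=> i k ltid ltkd; rewrite big_iota_ord.
  have /matrixP/(_ (Ordinal ltid) (Ordinal ltkd)) := mulmxV uA; rewrite !mxE => <-.
  apply: eq_bigr => j _; rewrite mxE; congr (_ * _).
  exact: (of_mxE _ j (Ordinal ltkd)).
have /matrixP/(_ (Ordinal ltid) (Ordinal ltkd)) := mulVmx uA; rewrite !mxE => <-.
apply: eq_bigr => j _; rewrite [to_mx _ _ _ _]mxE; congr (_ * _).
exact: (of_mxE _ (Ordinal ltid) j).
Qed.

Lemma left_inv_eq0 d (A : mat) (x : vec) : det d A <> 0 ->
  (forall i, (i < d)%N -> \sum_(j <- iota 0 d) A i j * x j = 0) ->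
  forall i, (i < d)%N -> x i = 0.
Proof.
move=> /inv_exists[S [_ SA]] Ax i ltid.
have -> : x i = \sum_(k <- iota 0 d) (\sum_(j <- iota 0 d) S i j * A j k) * x k.
  transitivity (\sum_(k <- iota 0 d) (i == k)%:R * x k).
    rewrite (bigD1_seq i) ?iota_uniq ?mem_iota //= eqxx mul1r.
    by rewrite big1 ?addr0 // => k; rewrite eq_sym => /negPf->; rewrite mul0r.
  by apply: eq_big_seq => k; rewrite mem_iota => /andP[_ ltkd]; rewrite SA.
under eq_bigr do rewrite big_distrl /=.
rewrite exchange_big big_seq big1 // => j; rewrite mem_iota => /andP[_ ltjd] /=.
under eq_bigr do rewrite -mulrA.
by rewrite -big_distrr /= Ax // mulr0.
Qed.

Lemma iota_bound n (P : nat -> Prop) : (forall j, (j < n)%N -> P j) ->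
  forall j, j \in iota 0 n -> P j.
Proof. by move=> h j; rewrite mem_iota => /andP[_]; exact: h. Qed.

Definition row_mass d (A : mat) : R :=
  rsum (iota 0 d) (fun i => rsum (iota 0 d) (fun j => Cnorm (A i j))).

Lemma row_mass_ge0 d A : (0 <= row_mass d A)%RR.
Proof. by apply: rsum_ge0 => i; apply: rsum_ge0 => j; exact: Cnorm_ge0. Qed.

Lemma matvec_le d A x i : (i < d)%N ->
  (Cnorm (matvec d A x i) <= row_mass d A * vnorm d x)%RR.
Proof.
move=> ltid; rewrite /matvec sumCE; apply: Rle_trans (Cnorm_sum _ _) _.
apply: (@Rle_trans _ (rsum (iota 0 d) (fun j => vnorm d x * Cnorm (A i j))))%RR.
  apply: rsum_le_in; apply: iota_bound => j ltjd.
  rewrite CnormM Rmult_comm; apply: Rmult_le_compat_r; first exact: Cnorm_ge0.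
  exact: le_vnorm.
rewrite rsumZ Rmult_comm; apply: Rmult_le_compat_r; first exact: vnorm_ge0.
apply: (@rsum_mem _ _ (fun i => rsum (iota 0 d) (fun j => Cnorm (A i j)))).
  by move=> k; apply: rsum_ge0 => j; exact: Cnorm_ge0.
by rewrite mem_iota.
Qed.

Lemma TmatE N B (mu : C) i j :
  Tmat N B mu i j = \sum_(k <- iota 0 N.+1) mu ^+ k * B k i j.
Proof. by rewrite /Tmat sumCE; apply: eq_bigr => k _; rewrite CpowE. Qed.

(* Injectivity of T(mu), uniform in small mu, as a perturbation of B_0. *)
Lemma Tmat_lower d N B : det d (B 0%N) <> 0 -> exists b e, (0 < b)%RR /\ (0 < e)%RR /\
  forall (mu : C) x, (Cnorm mu <= e)%RR -> (vnorm d x <= b * vnorm d (matvec d (Tmat N B mu) x))%RR.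
Proof.
move=> /inv_exists[S [_ SB]].
pose b0 := (row_mass d S + 1)%RR.
pose kap := (rsum (iota 1 N) (fun k => row_mass d (B k)) + 1)%RR.
have kap0 : (0 < kap)%RR.
  rewrite /kap; have := rsum_ge0 (iota 1 N) (fun k => row_mass_ge0 d (B k)); lra.
have b00 : (0 < b0)%RR by rewrite /b0; have := row_mass_ge0 d S; lra.
have bk : (0 < b0 * kap)%RR by apply: Rmult_lt_0_compat.
have i0 : (0 < / (2 * (b0 * kap)))%RR by apply: Rinv_0_lt_compat; lra.
(* Here |x| <= b0 |B_0 x| <= b0 |T(mu) x| + b0 kap |mu| |x|, and the threshold makes the last term
   at most |x|/2, whence the factor 2. The minimum with 1 gives |mu|^k <= |mu| for k >= 1. *)
exists (2 * b0)%RR, (Rmin 1 (/ (2 * (b0 * kap))))%RR; split; first lra.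
split; first by apply: Rmin_glb_lt; lra.
move=> mu x hmu; set y := matvec d (Tmat N B mu) x.
have mu1 : (Cnorm mu <= 1)%RR by apply: Rle_trans hmu (Rmin_l _ _).
have mu2 : (Cnorm mu <= / (2 * (b0 * kap)))%RR by apply: Rle_trans hmu (Rmin_r _ _).
have x0 := vnorm_ge0 d x; have y0 := vnorm_ge0 d y; have mu0 := Cnorm_ge0 mu.
have low i : (i < d)%N ->
    (Cnorm (matvec d (B 0%N) x i) <= vnorm d y + kap * Cnorm mu * vnorm d x)%RR.
  move=> ltid.
  pose rest := \sum_(k <- iota 1 N) mu ^+ k * matvec d (B k) x i.
  have yE : y i = matvec d (B 0%N) x i + rest.
    rewrite /y /matvec sumCE.
    transitivity (\sum_(k <- iota 0 N.+1) mu ^+ k * matvec d (B k) x i); last first.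
      by rewrite /= big_cons expr0 mul1r.
    under eq_bigr do rewrite TmatE CmulE big_distrl /=.
    rewrite exchange_big; apply: eq_bigr => k _; rewrite /matvec sumCE big_distrr /=.
    by apply: eq_bigr => j _; rewrite mulrA.
  have -> : matvec d (B 0%N) x i = y i - rest by rewrite yE addrK.
  apply: Rle_trans (CnormD _ _) _; rewrite CnormN; apply: Rplus_le_compat.
    exact: le_vnorm.
  apply: Rle_trans (Cnorm_sum _ _) _.
  apply: (@Rle_trans _ (rsum (iota 1 N) (fun k => (Cnorm mu * vnorm d x) * row_mass d (B k))))%RR.
    apply: rsum_le_in => k; rewrite mem_iota => /andP[k1 _].
    rewrite CnormM CnormX Rmult_assoc.
    apply: Rmult_le_compat; try exact: Cnorm_ge0; first exact: pow_le.
      case: k k1 => // k _; rewrite -tech_pow_Rmult -[X in (_ <= X)%RR]Rmult_1_r.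
      by apply: Rmult_le_compat_l => //; rewrite -(pow1 k); apply: pow_incr.
    by rewrite Rmult_comm; exact: matvec_le.
  rewrite rsumZ (_ : kap * Cnorm mu * vnorm d x = (Cnorm mu * vnorm d x) * kap)%RR; last ring.
  by apply: Rmult_le_compat_l; [exact: Rmult_le_pos|rewrite /kap; lra].
have lowv : (vnorm d (matvec d (B 0%N) x) <= vnorm d y + kap * Cnorm mu * vnorm d x)%RR.
  apply: vnorm_le => //; have := Rmult_le_pos _ _ (Rmult_le_pos _ _ (Rlt_le _ _ kap0) mu0) x0; lra.
have xb : (vnorm d x <= b0 * vnorm d (matvec d (B 0%N) x))%RR.
  apply: vnorm_le => [|i ltid]; first by apply: Rmult_le_pos; [lra|exact: vnorm_ge0].
  have -> : x i = matvec d S (matvec d (B 0%N) x) i.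
    rewrite /matvec sumCE; symmetry.
    transitivity (\sum_(j <- iota 0 d) \sum_(k <- iota 0 d) S i j * (B 0%N j k * x k)).
      apply: eq_bigr => j _; rewrite sumCE.
      by rewrite -[RHS]mulr_sumr.
    rewrite exchange_big /=.
    transitivity (\sum_(k <- iota 0 d) (i == k)%:R * x k).
      apply: eq_big_seq => k; rewrite mem_iota => /andP[_ ltkd].
      under eq_bigr do rewrite mulrA.
      by rewrite -big_distrl /= SB.
    rewrite (bigD1_seq i) ?iota_uniq ?mem_iota //= eqxx mul1r.
    by rewrite big1 ?addr0 // => k; rewrite eq_sym => /negPf->; rewrite mul0r.
  apply: Rle_trans (matvec_le _ _ ltid) _; apply: Rmult_le_compat_r; first exact: vnorm_ge0.
  by rewrite /b0; lra.
have h1 : (b0 * kap * Cnorm mu <= / 2)%RR.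
  apply: (@Rle_trans _ (b0 * kap * / (2 * (b0 * kap))))%RR; last by apply: Req_le; field; split; lra.
  by apply: Rmult_le_compat_l; lra.
have h2 : (b0 * kap * Cnorm mu * vnorm d x <= / 2 * vnorm d x)%RR.
  by apply: Rmult_le_compat_r.
have h3 : (b0 * vnorm d (matvec d (B 0%N) x) <= b0 * (vnorm d y + kap * Cnorm mu * vnorm d x))%RR.
  by apply: Rmult_le_compat_l => //; lra.
lra.
Qed.

Section Spectrum.
Variables (d N m : nat) (B : nat -> mat) (lam : vec).
Hypothesis B0 : det d (B 0%N) <> 0.
Hypothesis lam_lt1 : forall j, (j < m)%N -> (Cnorm (lam j) < 1)%RR.
Hypothesis nonres : forall a : nat -> nat, (2 <= mabs m a)%N ->
  det d (Tmat N B (xpow m lam a)) <> 0.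

Lemma lam_unif : exists rho, (0 <= rho < 1)%RR /\ forall j, (j < m)%N -> (Cnorm (lam j) <= rho)%RR.
Proof.
elim: m lam_lt1 => [|k IH] h; first by exists 0%RR; split; [lra|].
have [r [r01 hr]] := IH (fun j ltjk => h j (ltnW ltjk)).
exists (Rmax r (Cnorm (lam k))); split.
  by split; [apply: Rle_trans (Rmax_l _ _); lra | apply: Rmax_lub_lt; [lra | exact: h]].
move=> j; rewrite ltnS leq_eqVlt => /orP[/eqP->|/hr hj]; first exact: Rmax_r.
exact: Rle_trans hj (Rmax_l _ _).
Qed.

(** For |a| >= K the number lam^a is so small that [Tmat_lower] bounds the inverse by [b]; the
    finitely many remaining a are bounded by the sum [fin] of all their entries. *)
Lemma exists_Tinv : exists (S : 'X_{1..m} -> mat) (M : R), (0 <= M)%RR /\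
  (forall a i j, (i < d)%N -> (j < d)%N -> Cnorm (S a i j) <= M)%RR /\
  (forall a i j, (mdeg a < 2)%N -> S a i j = 0) /\
  (forall a i k, (2 <= mdeg a)%N -> (i < d)%N -> (k < d)%N ->
     \sum_(j <- iota 0 d) Tmat N B (xpow m lam (ext a)) i j * S a j k = (i == k)%:R).
Proof.
have /choice[S hS] : forall a : 'X_{1..m}, exists S : mat,
    (forall i j, (mdeg a < 2)%N -> S i j = 0) /\
    (forall i k, (2 <= mdeg a)%N -> (i < d)%N -> (k < d)%N ->
     \sum_(j <- iota 0 d) Tmat N B (xpow m lam (ext a)) i j * S j k = (i == k)%:R).
  move=> a; have [lt2|ge2] := ltnP (mdeg a) 2.
    by exists (fun _ _ => 0); split.
  have [|S [hS _]] := @inv_exists d (Tmat N B (xpow m lam (ext a))).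
    by apply: nonres; rewrite mabs_ext.
  by exists S; split=> // i k _; exact: hS.
have [b [e [b0 [e0 low]]]] := Tmat_lower N B0.
have [rho [[rho0 rho1] lr]] := lam_unif.
have [K hK] := pow_lt_1_zero rho ltac:(rewrite Rabs_right; lra) e e0.
pose fin := rsum (flat m K) (fun a => rsum (iota 0 d) (fun i => rsum (iota 0 d) (fun j => Cnorm (S a i j)))).
have fin0 : (0 <= fin)%RR.
  by apply: rsum_ge0 => a; apply: rsum_ge0 => i; apply: rsum_ge0 => j; exact: Cnorm_ge0.
exists S, (fin + b)%RR; split; first lra.
split; last by split=> [a i j lt2|a]; [exact: (hS a).1 | exact: (hS a).2].
move=> a i j ltid ltjd.
have [ltaK|leKa] := ltnP (mdeg a) K.
  have h1 := @rsum_mem _ (iota 0 d) (fun j => Cnorm (S a i j)) j (fun j => Cnorm_ge0 _).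
  have h2 := @rsum_mem _ (iota 0 d) (fun i => rsum (iota 0 d) (fun j => Cnorm (S a i j))) i
    (fun i => rsum_ge0 (iota 0 d) (fun j => Cnorm_ge0 (S a i j))).
  have h3 := @rsum_mem _ (flat m K)
     (fun a => rsum (iota 0 d) (fun i => rsum (iota 0 d) (fun j => Cnorm (S a i j)))) a
    (fun a => rsum_ge0 (iota 0 d) (fun i => rsum_ge0 (iota 0 d) (fun j => Cnorm_ge0 (S a i j)))).
  rewrite mem_iota ltjd in h1; rewrite mem_iota ltid in h2; rewrite mem_flat ltaK in h3.
  have {}h1 := h1 isT; have {}h2 := h2 isT; have {}h3 := h3 isT.
  apply: Rle_trans h1 _; apply: Rle_trans h2 _; apply: Rle_trans h3 _; rewrite -/fin; lra.
have [lt2|ge2] := ltnP (mdeg a) 2.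
  by rewrite (hS a).1 // Cnorm0; lra.
have mule : (Cnorm (xpow m lam (ext a)) <= e)%RR.
  apply: Rle_trans (Cnorm_xpow _ rho0 lr) _; rewrite mabs_ext.
  have := hK (mdeg a) ltac:(lia); rewrite Rabs_right; first lra.
  by apply: Rle_ge; exact: pow_le.
(* T(lam^a) sends column k of [S a] to a basis vector, so the lower bound for T bounds that
   column. *)
have colE k : (k < d)%N ->
    (vnorm d (matvec d (Tmat N B (xpow m lam (ext a))) (fun i => S a i k)) <= 1)%RR.
  move=> ltkd; apply: vnorm_le => [|l ltld]; first lra.
  rewrite /matvec sumCE [X in Cnorm X]((hS a).2 l k ge2 ltld ltkd).
  by case: (l == k); rewrite ?Cnorm1 ?Cnorm0; lra.
have := le_vnorm (fun i => S a i j) ltid; have := low _ (fun i => S a i j) mule.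
have := colE j ltjd.
set v1 := vnorm d (matvec _ _ _); set v2 := vnorm d _ => c1 c2 c3.
have : (b * v1 <= b * 1)%RR by apply: Rmult_le_compat_l; lra.
by lra.
Qed.

End Spectrum.

(** * From coefficient bounds to analytic functions *)

Lemma pow_half_small (A : R) eps : (0 <= A)%RR -> (0 < eps)%RR ->
  exists K, forall n, (K <= n)%N -> (A * (/ 2) ^ n < eps)%RR.
Proof.
move=> A0 e0.
have ea : (0 < eps / (A + 1))%RR by apply: Rmult_lt_0_compat => //; apply: Rinv_0_lt_compat; lra.
have [K hK] := pow_lt_1_zero (/ 2) ltac:(rewrite Rabs_right; lra) _ ea.
exists K => n leKn; have := hK n ltac:(lia).
have p0 := pow_le (/ 2) n ltac:(lra).
rewrite Rabs_right; last exact: Rle_ge.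
move=> h; apply: (@Rle_lt_trans _ ((A + 1) * (/ 2) ^ n)%RR); first by apply: Rmult_le_compat_r; lra.
have -> : (eps = (A + 1) * (eps / (A + 1)))%RR by field; lra.
by apply: Rmult_lt_compat_l => //; lra.
Qed.

Lemma pseries_exists n p (c : (nat -> nat) -> vec) l Rc :
  (0 <= l)%RR -> (0 < Rc)%RR ->
  (forall j k, (j < p)%N -> (mass n (coef_of c j) k <= l * Rc ^ k)%RR) ->
  exists f, pseries n p f c l Rc (/ (2 * Rc)).
Proof.
move=> l0 Rc0 ml.
have r0 : (0 < / (2 * Rc))%RR by apply: Rinv_0_lt_compat; lra.
have Rr : (Rc * / (2 * Rc) = / 2)%RR by field; lra.
have /choice[f hf] : forall z : vec, exists w : vec, forall j, (j < p)%N ->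
    (forall i, (i < n)%N -> Cnorm (z i) < / (2 * Rc))%RR ->
    Ccv (fun K => \sum_(k <- iota 0 K) chom n (coef_of c j) k z) (w j).
  move=> z; have [zr|nzr] := pselect (forall i, (i < n)%N -> Cnorm (z i) < / (2 * Rc))%RR; last first.
    (* Outside the polydisc the value is an arbitrary default. *)
    by exists vzero => j _ /nzr.
  have zr' i (ltin : (i < n)%N) := Rlt_le _ _ (zr i ltin).
  suff /choice[w hw] : forall j, exists w, (j < p)%N ->
      Ccv (fun K => \sum_(k <- iota 0 K) chom n (coef_of c j) k z) w by exists w => j /hw.
  move=> j; have [ltjp|] := ltnP j p; last by exists 0.
  have [|eps e0|w hw] := @Ccv_Cauchy (fun K => \sum_(k <- iota 0 K) chom n (coef_of c j) k z)
     (fun K => (2 * l) * (/ 2) ^ K)%RR; last by exists w.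
    move=> K k leKk; rewrite -(subnKC leKk) iotaD big_cat /= addrAC subrr add0r.
    have [_] := hom_tail K (k - K) l0 (Rlt_le _ _ Rc0) (fun k => ml j k ltjp)
      (Rlt_le _ _ r0) (Req_le _ _ Rr) zr'.
    by rewrite Rr add0n => h; apply: Rle_trans h _; apply: Req_le; ring.
  have [K hK] := @pow_half_small (2 * l) eps ltac:(lra) e0.
  by exists K; exact: hK.
by exists f; split=> //; [lra|move=> z j zr ltjp; exact: hf].
Qed.

(** The radius is shrunk to [rho] with Rc rho <= 1/4: there the mass bounds dominate the series of
    absolute values by a geometric one. *)
Lemma pseries_analytic n p f c l Rc r0 : pseries n p f c l Rc r0 -> analytic0 n p f.
Proof.
move=> ps; have [rho [[rho0 rhor] Rr]] := exists_rho ps.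
exists c, rho; split=> // z zr j /ltP ltjp.
have zr' i : (i < n)%N -> (Cnorm (z i) <= rho)%RR by move=> /ltP/zr; lra.
split; last first.
  apply/CseriesP; apply: (eq_Ccv _ (ps_val ps _ ltjp)) => [K|i /zr' ?]; last lra.
  by apply: eq_bigr => k _; rewrite sum_degCE; apply: eq_bigr => a _; rewrite monomialE.
pose u k := sum_deg Rplus 0%RR n k (fun a => Cnorm (c a j) * Cnorm (monomial n z a))%RR.
have u0 k : (0 <= u k)%RR.
  by rewrite /u sum_degRE; apply: rsum_ge0 => a; apply: Rmult_le_pos; exact: Cnorm_ge0.
have [s hs] : {s | Un_cv (fun K => sum_f_R0 u K) s}; last by exists s.
apply: growing_cv; first by move=> K /=; have := u0 K.+1; lra.
exists (l * ((Rc * rho) ^ 0 * 2))%RR => _ [K ->]; rewrite sum_f_R0E.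
have [h _] := hom_tail (rho := rho) 0 K.+1 (ps_l0 ps) (ps_R0 ps)
   (fun k => ps_mass ps k ltjp) (Rlt_le _ _ rho0) ltac:(lra) zr'.
apply: Rle_trans h; apply: rsum_le => k; rewrite /u sum_degRE /mass Rmult_comm -rsumZ.
apply: rsum_le_all (mi_mabs n k) _ => a /eqP ak; rewrite Rmult_comm.
apply: Rmult_le_compat_r; first exact: Cnorm_ge0.
by rewrite monomialE -ak; apply: Cnorm_xpow => //; lra.
Qed.

Lemma rsum_small (T : Type) (s : seq T) (F : T -> nat -> R) :
  (forall x eps, (0 < eps)%RR -> exists K, forall n, (K <= n)%N -> (F x n <= eps)%RR) ->
  forall eps, (0 < eps)%RR -> exists K, forall n, (K <= n)%N -> (rsum s (fun x => F x n) <= eps)%RR.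
Proof.
move=> h; elim: s => [|x s IH] eps e0; first by exists 0%N => n _; rewrite rsum_nil; lra.
have [K1 h1] := h x (eps / 2)%RR ltac:(lra).
have [K2 h2] := IH (eps / 2)%RR ltac:(lra).
exists (maxn K1 K2) => n; rewrite geq_max rsum_cons => /andP[/h1 ? /h2 ?]; lra.
Qed.

Lemma sum_iota_mul (A : nmodType) n d (F : nat -> A) :
  \sum_(q <- iota 0 (n * d)) F q =
  \sum_(k <- iota 0 n) \sum_(i <- iota 0 d) F (k * d + i)%N.
Proof.
elim: n => [|n IH]; first by rewrite mul0n !big_nil.
rewrite mulSnr iotaD big_cat IH sum_iotaS; congr (_ + _).
by rewrite add0n -[in LHS](addn0 (n * d)%N) iotaDl big_map.
Qed.

Lemma blocksE d N xs k i : (k <= N)%N -> (i < d)%N -> blocks d N xs (k * d + i)%N = xs k i.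
Proof.
move=> lekN ltid; rewrite /blocks.
have -> : Nat.ltb (k * d + i) (S N * d).
  by apply/Nat.ltb_spec0/ltP; apply: (@leq_trans (k.+1 * d)); [rewrite mulSn addnC ltn_add2r | rewrite leq_mul2r ltnS lekN orbT].
have dn0 : d <> 0%N by lia.
have e : (k * d + i)%N = (i + k * d)%coq_nat by lia.
by rewrite e Nat.div_add // Nat.Div0.mod_add Nat.div_small ?Nat.mod_small //; lia.
Qed.

Lemma blocks_ind d N (Q : nat -> C -> Prop) xs :
  (forall k i, (k <= N)%N -> (i < d)%N -> Q (k * d + i)%N (xs k i)) ->
  forall q, (q < N.+1 * d)%N -> Q q (blocks d N xs q).
Proof.
move=> h q ltq; have d0 : (0 < d)%N by move: ltq; case: (d); rewrite ?muln0.
have qE := divn_eq q d; have ltm : (q %% d < d)%N by rewrite ltn_mod.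
have led : (q %/ d <= N)%N by rewrite -ltnS ltn_divLR.
by rewrite qE blocksE //; exact: h.
Qed.

(** * Identity theorem *)

Lemma Cre_natr k : Cre (k%:R : C) = INR k.
Proof. by elim: k => [//|k IH]; rewrite -natr1 S_INR -IH. Qed.

Lemma poly_fun_eq0 K (A : nat -> C) :
  (forall x : C, \sum_(j <- iota 0 K) A j * x ^+ j = 0) -> forall j, (j < K)%N -> A j = 0.
Proof.
move=> h j ltjK; pose p := \poly_(j < K) A j.
have p0 : p = 0.
  apply/eqP/negPn/negP => pnorm0.
  (* K distinct roots 0, ..., K-1 for a polynomial of degree below K; real parts show that they are
     distinct. *)
  pose rs := [seq (i%:R : C) | i <- iota 0 K].
  have := max_poly_roots pnorm0 (rs := rs); rewrite size_map size_iota ltnNge size_poly.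
  move=> /(_ _ _)/negP; apply=> //.
    by apply/allP => x _; apply/rootP; rewrite horner_poly -[RHS](h x) big_iota_ord.
  rewrite map_inj_uniq ?iota_uniq // => a b /(congr1 Cre).
  by rewrite !Cre_natr => /INR_eq.
by have := coef_poly K A j; rewrite -/p p0 coef0 ltjK.
Qed.

Lemma hom_miS n k w (z : vec) : chom n.+1 w k z =
  \sum_(j <- iota 0 k.+1) chom n (fun a => w (miext n j a)) (k - j) z * z n ^+ j.
Proof.
rewrite /hom miS big_flatten big_map; apply: eq_bigr => j _; rewrite big_map mulr_suml.
apply: eq_bigr => a _; rewrite xpowS mulrA; congr (_ * _ * _).
  apply: eq_big_seq => i; rewrite mem_iota /miext => /andP[_ ltin].
  by case: Nat.eqb_spec => // e; lia.
by rewrite /miext Nat.eqb_refl.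
Qed.

Lemma hom_ext n k w (z z' : vec) : (forall i, (i < n)%N -> z i = z' i) ->
  chom n w k z = chom n w k z'.
Proof.
move=> zz'; apply: eq_bigr => a _; congr (_ * _); apply: eq_big_seq => i.
by rewrite mem_iota => /andP[_ ltin]; rewrite zz'.
Qed.

(** Induction on the number of variables: as a polynomial in the last variable the form vanishes
    identically, so each of its coefficients, a form in the other variables, vanishes at every
    point. *)
Lemma hom_eq0 n k w : (forall z : vec, chom n w k z = 0) -> all (fun a => w a == 0) (mi n k).
Proof.
elim: n k w => [|n IH] k w h.
  have := h vzero; rewrite /hom; case: k {h} => [|k] //=.
  by rewrite big_seq1 /xpow big_nil mulr1 andbT => /eqP.
rewrite miS all_flatten all_map; apply/allP => j; rewrite mem_iota => /andP[_ ltjk].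
rewrite /= all_map; apply: (IH (k - j)%N (fun a => w (miext n j a))) => z.
apply: (@poly_fun_eq0 k.+1 (fun j => chom n (fun a => w (miext n j a)) (k - j) z)) => // x.
pose z' : vec := fun i => if i == n then x else z i.
rewrite -[RHS](h z') hom_miS; apply: eq_bigr => i _; rewrite /z' eqxx; congr (_ * _).
by apply: hom_ext => i' ltin; case: eqP => // e; lia.
Qed.

Lemma hom_scale n k w (z : vec) (s : C) :
  chom n w k (fun i => s * z i) = s ^+ k * chom n w k z.
Proof.
rewrite /hom mulr_sumr; apply: (eq_sum_all (mi_mabs n k)) => a /eqP ak.
rewrite mulrCA; congr (_ * _); rewrite -ak mabsE /xpow -prodrXr -big_split.
by apply: eq_bigr => i _; rewrite exprMn.
Qed.

(** Homogeneity turns the bound at s z into s^k |h(z)| <= A (s V)^(k+1), where V exceeds |z|; divide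
    by s^k and let s tend to 0. *)
Lemma hom_small_eq0 n k w A r : (0 < r)%RR ->
  (forall rho (z : vec), 0 < rho < r -> (forall i, (i < n)%N -> Cnorm (z i) <= rho) ->
    Cnorm (chom n w k z) <= A * rho ^ k.+1)%RR ->
  all (fun a => w a == 0) (mi n k).
Proof.
move=> rp h; apply: hom_eq0 => z; apply: Cnorm_eq0; apply: Rle_antisym; last exact: Cnorm_ge0.
apply: Rle_eps => eps e0; rewrite Rplus_0_l.
pose V := (vnorm n z + 1)%RR; have V0 : (0 < V)%RR by rewrite /V; have := vnorm_ge0 n z; lra.
pose G := (Rabs A * V ^ k.+1 + 1)%RR.
have Vk : (0 < V ^ k.+1)%RR by exact: pow_lt.
have G0 : (0 < G)%RR by rewrite /G; have := Rmult_le_pos _ _ (Rabs_pos A) (Rlt_le _ _ Vk); lra.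
pose s := Rmin (r / (2 * V)) (eps / G).
have rv : (0 < r / (2 * V))%RR by apply: Rmult_lt_0_compat => //; apply: Rinv_0_lt_compat; lra.
have eg : (0 < eps / G)%RR by apply: Rmult_lt_0_compat => //; apply: Rinv_0_lt_compat.
have s0 : (0 < s)%RR by exact: Rmin_glb_lt.
have s1 : (s * V <= r / 2)%RR.
  apply: (@Rle_trans _ (r / (2 * V) * V)%RR); last by apply: Req_le; field; lra.
  by apply: Rmult_le_compat_r; [lra | exact: Rmin_l].
have s2 : (G * s <= eps)%RR.
  apply: (@Rle_trans _ (G * (eps / G))%RR); last by apply: Req_le; field; lra.
  by apply: Rmult_le_compat_l; [lra | exact: Rmin_r].
have sV : (0 < s * V)%RR by exact: Rmult_lt_0_compat.
have := h (s * V)%RR (fun i => mkC s 0 * z i) ltac:(lra).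
rewrite hom_scale CnormM CnormX Cnorm_real; last lra.
move=> /(_ _) h1; have sk : (0 < s ^ k)%RR by exact: pow_lt.
apply: (Rmult_le_reg_l _ _ _ sk); apply: Rle_trans (h1 _) _.
  move=> i ltin; rewrite CnormM Cnorm_real; last lra.
  by apply: Rmult_le_compat_l; [lra | rewrite /V; have := le_vnorm z ltin; lra].
rewrite Rpow_mult_distr -tech_pow_Rmult.
have -> : (A * (s * s ^ k * V ^ k.+1) = s ^ k * (A * V ^ k.+1 * s))%RR by ring.
apply: Rmult_le_compat_l; first lra.
apply: Rle_trans s2; apply: Rmult_le_compat_r; first lra.
have : (A * V ^ k.+1 <= Rabs A * V ^ k.+1)%RR by apply: Rmult_le_compat_r; [lra | exact: Rle_abs].
rewrite /G; lra.
Qed.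

Lemma pseries_weaken n p f c l Rc r0 l' Rc' r0' : pseries n p f c l Rc r0 ->
  (l <= l')%RR -> (Rc <= Rc')%RR -> (0 < r0' <= r0)%RR -> pseries n p f c l' Rc' r0'.
Proof.
move=> ps ll RR [rp rr]; have l0 := ps_l0 ps; have R0 := ps_R0 ps; split=> //; try lra.
  move=> j k ltjp; apply: Rle_trans (ps_mass ps k ltjp) _.
  by apply: Rmult_le_compat => //; [exact: pow_le | apply: pow_incr; lra].
by move=> z j zr; apply: (ps_val ps) => i /zr; lra.
Qed.

(** One choice of radius for the four smallness conditions that occur together, in the existence
    proof as well as in the uniqueness proof. *)
Lemma exists_small G1 G2 r1 r2 e1 e2 : (0 <= G1)%RR -> (0 <= G2)%RR -> (0 < r1)%RR -> (0 < r2)%RR ->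
  (0 < e1)%RR -> (0 < e2)%RR ->
  exists rr, (0 < rr)%RR /\ forall rho, (0 <= rho <= rr)%RR ->
    (rho < r1 /\ rho < r2 /\ G1 * rho < e1 /\ G2 * rho < e2)%RR.
Proof.
move=> G10 G20 r10 r20 e10 e20.
have a1 : (0 < e1 / (G1 + 1))%RR by apply: Rmult_lt_0_compat => //; apply: Rinv_0_lt_compat; lra.
have a2 : (0 < e2 / (G2 + 1))%RR by apply: Rmult_lt_0_compat => //; apply: Rinv_0_lt_compat; lra.
pose rr := (Rmin (Rmin r1 r2) (Rmin (e1 / (G1 + 1)) (e2 / (G2 + 1))) / 2)%RR.
have m0 : (0 < Rmin (Rmin r1 r2) (Rmin (e1 / (G1 + 1)) (e2 / (G2 + 1))))%RR.
  by apply: Rmin_glb_lt; apply: Rmin_glb_lt.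
have m1 := Rmin_l (Rmin r1 r2) (Rmin (e1 / (G1 + 1)) (e2 / (G2 + 1))).
have m2 := Rmin_r (Rmin r1 r2) (Rmin (e1 / (G1 + 1)) (e2 / (G2 + 1))).
have m3 := Rmin_l r1 r2; have m4 := Rmin_r r1 r2.
have m5 := Rmin_l (e1 / (G1 + 1)) (e2 / (G2 + 1)); have m6 := Rmin_r (e1 / (G1 + 1)) (e2 / (G2 + 1)).
have key G e rho : (0 <= G)%RR -> (0 < e / (G + 1))%RR -> (0 <= rho < e / (G + 1))%RR -> (G * rho < e)%RR.
  move=> G0 e0 [rho0 rhoe].
  have -> : (e = (G + 1) * (e / (G + 1)))%RR by field; lra.
  apply: (@Rle_lt_trans _ ((G + 1) * rho)%RR); first by apply: Rmult_le_compat_r; lra.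
  by apply: Rmult_lt_compat_l; lra.
exists rr; rewrite /rr; split; first lra.
by move=> rho rhor; do !split; try lra; apply: key => //; lra.
Qed.

(** * Existence and uniqueness of the parameterization *)

Section Invariance.
Variables (d N m : nat) (B : nat -> mat) (lam : vec) (v : nat -> vec).
Variables (Z : vec -> vec) (c : (nat -> nat) -> vec) (l Rc r0 : R).
Let D := (N.+1 * d)%N.
Hypothesis psZ : pseries D d Z c l Rc r0.
Hypothesis c0 : forall j, (j < d)%N -> const (coef_of c j) = 0.
Hypothesis cB : forall k i j, (k <= N)%N -> (i < d)%N -> (j < d)%N ->
  c (unit_mi (k * d + i)%N) j = B k j i.
Hypothesis B0 : det d (B 0%N) <> 0.
Hypothesis lam_lt1 : forall j, (j < m)%N -> (Cnorm (lam j) < 1)%RR.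
Hypothesis nonres : forall a : nat -> nat, (2 <= mabs m a)%N ->
  det d (Tmat N B (xpow m lam a)) <> 0.
Hypothesis eig : forall q i, (q < m)%N -> (i < d)%N ->
  \sum_(k <- iota 0 d) Tmat N B (lam q) i k * v q k = 0.

Let l0 := ps_l0 psZ.
Let Rc0 := ps_R0 psZ.

Local Notation la a := (xpow m lam (ext a)).
Implicit Types (a : 'X_{1..m}).

Lemma la_le1 a k : (Cnorm (la a ^+ k) <= 1)%RR.
Proof.
rewrite CnormX -(pow1 k); apply: pow_incr; split; first exact: Cnorm_ge0.
rewrite -(pow1 (mabs m (ext a))); apply: Cnorm_xpow; first lra.
by move=> i /lam_lt1; lra.
Qed.

Lemma LampowE k (z : vec) j : Lampow lam k z j = lam j ^+ k * z j.
Proof. by rewrite /Lampow CpowE. Qed.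

Lemma Lampow_le k (z : vec) t : (forall i, (i < m)%N -> Cnorm (z i) <= t)%RR ->
  forall i, (i < m)%N -> (Cnorm (Lampow lam k z i) <= t)%RR.
Proof.
move=> zt i ltim; rewrite LampowE CnormM CnormX.
apply: Rle_trans (zt i ltim); rewrite -[X in (_ <= X)%RR]Rmult_1_l.
apply: Rmult_le_compat_r; first exact: Cnorm_ge0.
rewrite -(pow1 k); apply: pow_incr; split; first exact: Cnorm_ge0.
by have := lam_lt1 ltim; lra.
Qed.

Lemma xpow_Lampow k (z : vec) (a : nat -> nat) :
  xpow m (Lampow lam k z) a = xpow m lam a ^+ k * xpow m z a.
Proof.
rewrite /xpow -prodrXl -big_split; apply: eq_bigr => i _.
by rewrite LampowE exprMn -!exprM mulnC.
Qed.

Lemma lin_blocks j (x : nat -> vec) : (j < d)%N ->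
  lin D (coef_of c j) (blocks d N x) =
  \sum_(k <- iota 0 N.+1) \sum_(i <- iota 0 d) B k j i * x k i.
Proof.
move=> ltjd; rewrite /lin sum_iota_mul; apply: eq_big_seq => k; rewrite mem_iota => /andP[_ ltk].
apply: eq_big_seq => i; rewrite mem_iota => /andP[_ ltid].
by rewrite blocksE // /coef_of cB.
Qed.

Lemma lin_le j (x : vec) dl : (j < d)%N -> (0 <= dl)%RR ->
  (forall q, (q < D)%N -> Cnorm (x q) <= dl)%RR ->
  (Cnorm (lin D (coef_of c j) x) <= l * Rc * dl)%RR.
Proof.
move=> ltjd dl0 xd; rewrite -hom_1.
apply: (@Rle_trans _ (mass D (coef_of c j) 1 * dl ^ 1)%RR).
  exact: (hom_le Cnorm_ring_norm).
rewrite /= Rmult_1_r; apply: Rmult_le_compat_r => //.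
by have := ps_mass psZ 1 ltjd; rewrite /= Rmult_1_r.
Qed.

(* The linearized operator P |-> sum_k B_k P(Lambda^k z), which is diagonal on
   monomials: it acts on the coefficient of z^a by T(lam^a). *)
Definition Lop (P : nat -> {mpoly C[m]}) j : {mpoly C[m]} :=
  \sum_(i <- iota 0 d) diag (fun a => Tmat N B (la a) j i) (P i).

Definition pev (P : nat -> {mpoly C[m]}) (z : vec) : vec :=
  fun i => (P i).@[fun i : 'I_m => z i].

Lemma meval_diag g (p : {mpoly C[m]}) (z : vec) :
  (diag g p).@[fun i : 'I_m => z i] = \sum_(a <- msupp p) g a * p@_a * xpow m z (ext a).
Proof.
rewrite /diag raddf_sum /=; apply: eq_bigr => a _.
by rewrite mevalZ mevalX xpow_ext.
Qed.

Lemma pev_Lampow k P (z : vec) i :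
  pev P (Lampow lam k z) i = (diag (fun a => la a ^+ k) (P i)).@[fun i : 'I_m => z i].
Proof.
rewrite meval_diag /pev mevalE; apply: eq_bigr => a _.
rewrite -xpow_ext xpow_Lampow mulrA; congr (_ * _); exact: mulrC.
Qed.

Lemma meval_Lop P (z : vec) j : (j < d)%N ->
  (Lop P j).@[fun i : 'I_m => z i] =
  lin D (coef_of c j) (blocks d N (fun k => pev P (Lampow lam k z))).
Proof.
move=> ltjd; rewrite lin_blocks // exchange_big /= /Lop raddf_sum /=.
apply: eq_bigr => i _; rewrite meval_diag.
under [RHS]eq_bigr do rewrite pev_Lampow meval_diag mulr_sumr.
rewrite exchange_big; apply: eq_bigr => a _.
rewrite TmatE !mulr_suml; apply: eq_bigr => k _; cring.
Qed.

(* The flattened block vector of the polynomials P_i(Lambda^k z). *)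
Definition shifts (P : nat -> {mpoly C[m]}) (q : nat) : {mpoly C[m]} :=
  if (q < D)%N then diag (fun a => la a ^+ (q %/ d)%N) (P (q %% d)%N) else 0.

Lemma ltn_modD q : (q < D)%N -> (q %% d < d)%N.
Proof. by move=> ltq; rewrite ltn_mod; move: ltq; rewrite /D; case: (d); rewrite ?muln0. Qed.

Lemma meval_shifts P (z : vec) q : (q < D)%N ->
  (shifts P q).@[fun i : 'I_m => z i] = blocks d N (fun k => pev P (Lampow lam k z)) q.
Proof.
move=> ltq; rewrite /shifts ltq -pev_Lampow.
rewrite [in RHS](divn_eq q d) blocksE //; last exact: ltn_modD.
by rewrite -ltnS ltn_divLR //; have := ltn_modD ltq; case: (d).
Qed.

(** Stability enters here: |lam^a|^k <= 1, so all the shifted copies stay in the ball of [P]. *)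
Lemma shifts_le t P rho q : (0 <= t)%RR -> (forall i, (i < d)%N -> pnorm t (P i) <= rho)%RR ->
  (q < D)%N -> (pnorm t (shifts P q) <= rho)%RR.
Proof.
move=> t0 Pr ltq; rewrite /shifts ltq; apply: Rle_trans (Pr _ (ltn_modD ltq)).
apply: Rle_trans (pnorm_diag (G := 1%RR) _ t0 _) _; last by lra.
by move=> a; exact: la_le1.
Qed.

Lemma shiftsB P Q q : shifts P q - shifts Q q = shifts (fun i => P i - Q i) q.
Proof. by rewrite /shifts; case: ifP => _; rewrite ?subr0 // diagB. Qed.

Local Notation pnonlin := (nonlin (fun x : C => x%:MP : {mpoly C[m]}) D).
Local Notation phom := (hom (fun x : C => x%:MP : {mpoly C[m]}) D).

Lemma meval_nonlin j K P (z : vec) :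
  (pnonlin (coef_of c j) K (shifts P)).@[fun i : 'I_m => z i] =
  cnonlin D (coef_of c j) K (blocks d N (fun k => pev P (Lampow lam k z))).
Proof.
rewrite /nonlin raddf_sum /=; apply: eq_bigr => k _.
rewrite /hom raddf_sum /=; apply: eq_bigr => a _.
rewrite mevalM mevalC; congr (_ * _); rewrite /xpow rmorph_prod /=.
apply: eq_big_seq => q; rewrite mem_iota => /andP[_ ltq].
by rewrite rmorphXn /= meval_shifts.
Qed.

(** Vanishing order at least [k] at 0, that is, membership in the k-th power of the ideal generated
    by the variables. *)
Definition low k (p : {mpoly C[m]}) := forall a, (mdeg a < k)%N -> p@_a = 0.

Lemma low_mul k1 k2 p q : low k1 p -> low k2 q -> low (k1 + k2) (p * q).
Proof.
move=> lp lq a lta; rewrite mcoeffM big1 // => -[b1 b2] /= /eqP e.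
have := mdegD b1 b2; rewrite -e => e'.
have [lt1|ge1] := ltnP (mdeg b1) k1; first by rewrite lp ?mul0r.
by rewrite lq ?mulr0 //; lia.
Qed.

Lemma low0 p : low 0 p. Proof. by []. Qed.

Lemma low_xpow n (x : nat -> {mpoly C[m]}) (a : nat -> nat) : (forall q, low 1 (x q)) ->
  low (mabs n a) (xpow n x a).
Proof.
move=> lx; elim: n => [|n IH]; first exact: low0.
rewrite xpowS mabsS; apply: low_mul => //.
elim: (a n) => [|k IHk]; first exact: low0.
by rewrite exprS; apply: (@low_mul 1 k).
Qed.

(** The right-hand side of the linear equation is thus supported on |a| >= 2, where T(lam^a) is
    invertible. *)
Lemma low_nonlin j K P : (forall i, low 1 (P i)) -> low 2 (pnonlin (coef_of c j) K (shifts P)).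
Proof.
move=> lP; have lX q : low 1 (shifts P q).
  by rewrite /shifts; case: ifP => _ a lta; rewrite ?mcoeff0 // mcoeff_diag lP ?mulr0.
move=> a lta; rewrite /nonlin raddf_sum big_seq big1 // => k.
rewrite mem_iota => /andP[k2 _]; rewrite /hom /= raddf_sum /=.
transitivity (\sum_(x <- mi D k) (0 : C)); last by rewrite big1.
apply: (eq_sum_all (mi_mabs D k)) => x /eqP xk.
rewrite mcoeffCM.
have -> : (xpow D (shifts P) x)@_a = 0; last by rewrite mulr0.
have h : low (mabs D x) (xpow D (shifts P) x) by exact: low_xpow.
by apply: h; rewrite xk; exact: leq_trans k2.
Qed.

(** * Existence: Picard iteration on polynomials *)

Section Iteration.
Variables (S : 'X_{1..m} -> mat) (M : R).
Hypothesis M0 : (0 <= M)%RR.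
Hypothesis SM : forall a i j, (i < d)%N -> (j < d)%N -> (Cnorm (S a i j) <= M)%RR.
Hypothesis Slow : forall a i j, (mdeg a < 2)%N -> S a i j = 0.
Hypothesis TS : forall a i k, (2 <= mdeg a)%N -> (i < d)%N -> (k < d)%N ->
     \sum_(j <- iota 0 d) Tmat N B (la a) i j * S a j k = (i == k)%:R.

Definition linpart (i : nat) : {mpoly C[m]} := \sum_(q < m) v q i *: 'X_q.

(** Right inverse of [Lop] on polynomials of order at least 2; it kills all terms of degree below
    2. *)
Definition Sop (F : nat -> {mpoly C[m]}) (i : nat) : {mpoly C[m]} :=
  \sum_(k <- iota 0 d) diag (fun a => S a i k) (F k).

(* Picard iteration for Lop P = - nonlinear part of Z; the n-th step uses only the
   terms of Z of degree at most n, so that everything stays polynomial. *)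
Fixpoint Piter (n : nat) : nat -> {mpoly C[m]} :=
  match n with
  | 0%N => linpart
  | n'.+1 => fun i => linpart i - Sop (fun k => pnonlin (coef_of c k) n' (shifts (Piter n'))) i
  end.
Arguments Piter : simpl never.
Definition Fiter n k := pnonlin (coef_of c k) n (shifts (Piter n)).

Lemma PiterS n i : Piter n.+1 i = linpart i - Sop (Fiter n) i. Proof. by []. Qed.

Lemma linpart0 i : (linpart i)@_0%MM = 0.
Proof.
rewrite /linpart raddf_sum /= big1 // => q _; rewrite mcoeffZ mcoeffX.
have -> : (U_(q)%MM == 0%MM :> 'X_{1..m}) = false by apply/negP => /eqP/(congr1 mdeg); rewrite mdeg1 mdeg0.
by rewrite mulr0.
Qed.

Lemma mcoeff_linpart i (q : 'I_m) : (linpart i)@_U_(q) = v q i.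
Proof.
rewrite /linpart raddf_sum /= (bigD1 q) //= mcoeffZ mcoeffXU eqxx mulr1 big1 ?addr0 // => k kq.
by rewrite mcoeffZ mcoeffXU (negPf kq) mulr0.
Qed.

Lemma mcoeff_linpart_high i a : (2 <= mdeg a)%N -> (linpart i)@_a = 0.
Proof.
move=> ge2; rewrite /linpart raddf_sum /= big1 // => q _; rewrite mcoeffZ mcoeffX.
case: eqP => [e|_]; last by rewrite mulr0.
by move: ge2; rewrite -e mdeg1.
Qed.

Lemma Sop_low F i a : (mdeg a < 2)%N -> (Sop F i)@_a = 0.
Proof.
by move=> lt2; rewrite /Sop raddf_sum /= big1 // => k _; rewrite mcoeff_diag Slow ?mul0r.
Qed.

Lemma Piter_low n i a : (mdeg a < 2)%N -> (Piter n i)@_a = (linpart i)@_a.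
Proof. by move=> lt2; case: n => [//|n]; rewrite PiterS mcoeffB Sop_low ?subr0. Qed.

Lemma Piter_low1 n i : low 1 (Piter n i).
Proof.
move=> a; rewrite ltnS leqn0 => a0; rewrite Piter_low; last by rewrite (eqP a0).
by move: a0; rewrite mdeg_eq0 => /eqP ->; exact: linpart0.
Qed.

(** Each iterate solves the linear equation exactly, with the previous nonlinear term on the right.
    Degree 0 vanishes on both sides, degree 1 is the eigenvector equation, and from degree 2 on
    T(lam^a) cancels its inverse. *)
Lemma Lop_Piter n j : (j < d)%N -> Lop (Piter n.+1) j = - Fiter n j.
Proof.
move=> ltjd; apply/mpolyP => a; rewrite /Lop raddf_sum /= mcoeffN.
have Flow : low 2 (Fiter n j) by apply: low_nonlin => i; exact: Piter_low1.
under eq_bigr do rewrite mcoeff_diag.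
have [lt2|ge2] := ltnP (mdeg a) 2.
  rewrite Flow // oppr0.
  have [/eqP d0|dn0] := boolP (mdeg a == 0%N).
    by rewrite big1 // => i _; rewrite Piter_low1 ?mulr0 // d0.
  have /mdeg1P[q /eqP ->] : mdeg a == 1%N by lia.
  rewrite -[RHS](eig (ltn_ord q) ltjd); apply: eq_bigr => i _.
  rewrite Piter_low ?mdeg1 // mcoeff_linpart; congr (Tmat _ _ _ _ _ * _).
  rewrite xpow_ext (bigD1 q) //= mnm1E eqxx expr1 big1 ?mulr1 // => k kq.
  by rewrite mnm1E eq_sym (negPf kq) expr0.
transitivity (- \sum_(k <- iota 0 d) (\sum_(i <- iota 0 d) Tmat N B (la a) j i * S a i k) * (Fiter n k)@_a).
  rewrite -sumrN; under [RHS]eq_bigr do rewrite mulr_suml -sumrN.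
  rewrite exchange_big; apply: eq_bigr => i _.
  rewrite PiterS mcoeffB mcoeff_linpart_high // sub0r mulrN /Sop raddf_sum /= mulr_sumr -sumrN.
  by apply: eq_bigr => k _; rewrite mcoeff_diag mulrA.
congr (- _); rewrite (bigD1_seq j) ?iota_uniq ?mem_iota //= TS // eqxx mul1r.
rewrite big_seq_cond big1 ?addr0 // => k; rewrite mem_iota => /andP[/andP[_ ltkd] kj].
by rewrite TS // eq_sym (negPf kj) mul0r.
Qed.

Lemma pnorm_Sop t F f i : (0 <= t)%RR -> (i < d)%N -> (forall k, (k < d)%N -> pnorm t (F k) <= f)%RR ->
  (pnorm t (Sop F i) <= INR d * M * f)%RR.
Proof.
move=> t0 ltid Ff; apply: Rle_trans (pnorm_sum t0 _ _) _.
apply: (@Rle_trans _ (rsum (iota 0 d) (fun _ => M * f))%RR); last first.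
  by rewrite rsum_const size_iota; apply: Req_le; ring.
apply: rsum_le_in => k; rewrite mem_iota => /andP[_ ltkd].
apply: (@Rle_trans _ (M * pnorm t (F k))%RR); last by apply: Rmult_le_compat_l => //; exact: Ff.
by apply: pnorm_diag => // a; exact: SM.
Qed.

Lemma SopB F G i : Sop F i - Sop G i = Sop (fun k => F k - G k) i.
Proof. by rewrite /Sop -sumrB; apply: eq_bigr => k _; rewrite diagB. Qed.

Let sv : R := (rsum (iota 0 d) (fun i => rsum (iota 0 m) (fun q => Cnorm (v q i))) + 1)%RR.

Lemma sv_gt0 : (0 < sv)%RR.
Proof.
have : (0 <= rsum (iota 0 d) (fun i => rsum (iota 0 m) (fun q => Cnorm (v q i))))%RR.
  by apply: rsum_ge0 => i; apply: rsum_ge0 => q; exact: Cnorm_ge0.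
by rewrite /sv; lra.
Qed.

Lemma pnorm_Vp t i : (0 <= t)%RR -> (i < d)%N -> (pnorm t (linpart i) <= sv * t)%RR.
Proof.
move=> t0 ltid; rewrite /linpart.
apply: (@Rle_trans _ (rsum (iota 0 m) (fun q => Cnorm (v q i)) * t)%RR).
  have -> : \sum_(q < m) v q i *: 'X_q = \sum_(q <- enum 'I_m) v q i *: 'X_q :> {mpoly C[m]}.
    by rewrite big_enum.
  apply: Rle_trans (pnorm_sum t0 _ _) _.
  have -> : rsum (iota 0 m) (fun q => Cnorm (v q i)) = rsum (enum 'I_m) (fun q : 'I_m => Cnorm (v q i)).
    by rewrite -val_enum_ord rsum_map.
  rewrite Rmult_comm -rsumZ; apply: rsum_le => q.
  have h := pnormZX t (v q i) U_(q)%MM; rewrite mdeg1 pow_1 Rmult_comm in h; exact: h.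
apply: Rmult_le_compat_r => //.
have := @rsum_mem _ (iota 0 d) (fun i => rsum (iota 0 m) (fun q => Cnorm (v q i))) i
  (fun i => rsum_ge0 (iota 0 m) (fun q => Cnorm_ge0 (v q i))).
rewrite mem_iota ltid => /(_ isT) h; rewrite /sv; apply: Rle_trans h _.
by rewrite -[X in (X <= _)%RR]Rplus_0_r; apply: Rplus_le_compat_l; lra.
Qed.

(** [tE] gives the linear part norm at most rho/2, half of the ball. [Grho] makes the fixed-point
    map 1/4-Lipschitz on the ball of radius [rho], so the nonlinear correction costs at most another
    rho/4. *)
Variables (rho t : R).
Hypothesis rho0 : (0 < rho < r0)%RR.
Hypothesis Rrho : (Rc * rho <= / 4)%RR.
Let kap := (8 * l * Rc * Rc)%RR.
Hypothesis Grho : (INR d * M * kap * rho <= / 4)%RR.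
Hypothesis tE : (rho = 2 * sv * t)%RR.

Lemma t_gt0 : (0 < t)%RR.
Proof. have := sv_gt0; nra. Qed.
Let t0 := Rlt_le _ _ t_gt0.

Lemma kap_ge0 : (0 <= kap)%RR.
Proof. by rewrite /kap; apply: Rmult_le_pos => //; apply: Rmult_le_pos => //; lra. Qed.

Lemma dM_ge0 : (0 <= INR d * M)%RR.
Proof. by apply: Rmult_le_pos => //; exact: pos_INR. Qed.

Lemma pnonlin_lip k K P Q dl : (k < d)%N -> (0 <= dl)%RR ->
  (forall i, (i < d)%N -> pnorm t (P i) <= rho)%RR ->
  (forall i, (i < d)%N -> pnorm t (Q i) <= rho)%RR ->
  (forall i, (i < d)%N -> pnorm t (P i - Q i) <= dl)%RR ->
  (pnorm t (pnonlin (coef_of c k) K (shifts P) - pnonlin (coef_of c k) K (shifts Q)) <= kap * rho * dl)%RR.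
Proof.
move=> ltkd dl0 hP hQ hPQ; apply: (nonlin_lip (pnorm_ring_norm m t0)) => //; try lra.
- by move=> i; exact: (ps_mass psZ).
move=> q ltq; split; first exact: shifts_le.
by split; [exact: shifts_le | rewrite shiftsB; exact: shifts_le].
Qed.

Lemma pnonlin_le k K P : (k < d)%N -> (forall i, (i < d)%N -> pnorm t (P i) <= rho)%RR ->
  (pnorm t (pnonlin (coef_of c k) K (shifts P)) <= kap * rho * rho)%RR.
Proof.
move=> ltkd hP; apply: (nonlin_le (pnorm_ring_norm m t0)) => //; try lra.
- by move=> i; exact: (ps_mass psZ).
by move=> q ltq; exact: shifts_le.
Qed.

Lemma Piter_le n i : (i < d)%N -> (pnorm t (Piter n i) <= rho)%RR.
Proof.
have vb j : (j < d)%N -> (pnorm t (linpart j) <= rho / 2)%RR.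
  by move=> ltjd; apply: Rle_trans (pnorm_Vp t0 ltjd) _; rewrite tE; lra.
elim: n i => [|n IH] i ltid; first by have := vb i ltid; rewrite -[Piter 0 i]/(linpart i); lra.
rewrite PiterS; apply: Rle_trans (pnormD t0 _ _) _; rewrite pnormN.
have := vb i ltid; have := @pnorm_Sop t (Fiter n) (kap * rho * rho)%RR i t0 ltid
   (fun k ltkd => pnonlin_le n ltkd IH).
have : (INR d * M * kap * rho * rho <= / 4 * rho)%RR by apply: Rmult_le_compat_r; lra.
lra.
Qed.

Let A := (INR d * M * l)%RR.

Lemma A_ge0 : (0 <= A)%RR.
Proof. by apply: Rmult_le_pos => //; exact: dM_ge0. Qed.

Lemma Piter_step n i : (i < d)%N -> (pnorm t (Piter n.+1 i - Piter n i) <= A * (/ 2) ^ n)%RR.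
Proof.
elim: n i => [|n IH] i ltid.
  rewrite PiterS -[Piter 0 i]/(linpart i) addrC addKr pnormN.
  have := @pnorm_Sop t (Fiter 0) 0%RR i t0 ltid => h; apply: Rle_trans (h _) _.
    by move=> k _; rewrite /Fiter /nonlin /= big_nil pnorm0; lra.
  by have := A_ge0; rewrite /=; lra.
have -> : Piter n.+2 i - Piter n.+1 i = - Sop (fun k => Fiter n.+1 k - Fiter n k) i.
  by rewrite -SopB !PiterS opprB addrC subrKA opprB.
rewrite pnormN.
have p2 := pow_le (/ 2) n ltac:(lra).
have p4 : ((/ 4) ^ n <= (/ 2) ^ n)%RR by apply: pow_incr; lra.
have A0 := A_ge0.
have b k : (k < d)%N -> (pnorm t (Fiter n.+1 k - Fiter n k) <=
    kap * rho * (A * (/ 2) ^ n) + l * (/ 4 * (/ 2) ^ n))%RR.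
  move=> ltkd.
  have -> : Fiter n.+1 k - Fiter n k =
    (pnonlin (coef_of c k) n.+1 (shifts (Piter n.+1)) - pnonlin (coef_of c k) n.+1 (shifts (Piter n)))
    + phom (coef_of c k) (2 + n) (shifts (Piter n)).
    have -> : pnonlin (coef_of c k) n.+1 (shifts (Piter n)) =
       Fiter n k + phom (coef_of c k) (2 + n) (shifts (Piter n)).
      by rewrite /Fiter /nonlin iotaSr -cats1 big_cat /= big_seq1.
    by rewrite opprD addrA subrK.
  apply: Rle_trans (pnormD t0 _ _) _; apply: Rplus_le_compat.
    apply: pnonlin_lip => // [|j ltjd|j ltjd]; try exact: Piter_le.
    by apply: Rmult_le_pos.
  apply: (@Rle_trans _ (mass D (coef_of c k) (2 + n) * rho ^ (2 + n)%N)%RR).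
    apply: (hom_le (pnorm_ring_norm m t0)); first lra.
    by move=> q ltq; apply: shifts_le => // j; exact: Piter_le.
  apply: (@Rle_trans _ (l * (Rc * rho) ^ (2 + n)%N)%RR).
    rewrite Rpow_mult_distr -Rmult_assoc; apply: Rmult_le_compat_r; first by apply: pow_le; lra.
    exact: (ps_mass psZ).
  apply: Rmult_le_compat_l => //.
  apply: (@Rle_trans _ ((/ 4) ^ (2 + n)%N)%RR).
    by apply: pow_incr; split => //; apply: Rmult_le_pos => //; lra.
  by rewrite -[(2 + n)%N]/(n.+2) -!tech_pow_Rmult; lra.
apply: Rle_trans (pnorm_Sop t0 ltid b) _; rewrite -tech_pow_Rmult.
have : (INR d * M * kap * rho * (A * (/ 2) ^ n) <= / 4 * (A * (/ 2) ^ n))%RR.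
  by apply: Rmult_le_compat_r => //; exact: Rmult_le_pos.
have := Rmult_le_pos _ _ A0 p2.
have -> : (INR d * M * (kap * rho * (A * (/ 2) ^ n) + l * (/ 4 * (/ 2) ^ n)) =
  INR d * M * kap * rho * (A * (/ 2) ^ n) + / 4 * (A * (/ 2) ^ n))%RR by rewrite /A; ring.
lra.
Qed.

Definition err n : R := (2 * A * (/ 2) ^ n)%RR.

Lemma err_ge0 n : (0 <= err n)%RR.
Proof. by apply: Rmult_le_pos; [have := A_ge0; lra | apply: pow_le; lra]. Qed.

Lemma err_small eps : (0 < eps)%RR -> exists K, forall n, (K <= n)%N -> (err n < eps)%RR.
Proof. by move=> e0; apply: pow_half_small => //; have := A_ge0; lra. Qed.

Lemma Piter_cauchy n k i : (n <= k)%N -> (i < d)%N -> (pnorm t (Piter k i - Piter n i) <= err n)%RR.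
Proof.
move=> lenk ltid; rewrite -(subnKC lenk).
have : (pnorm t (Piter (n + (k - n)) i - Piter n i) <= 2 * A * ((/ 2) ^ n - (/ 2) ^ (n + (k - n))%N))%RR.
  elim: (k - n)%N => [|e IH]; first by rewrite addn0 subrr pnorm0; lra.
  have -> : Piter (n + e.+1) i - Piter n i = (Piter (n + e).+1 i - Piter (n + e) i) + (Piter (n + e) i - Piter n i).
    by rewrite addnS subrKA.
  apply: Rle_trans (pnormD t0 _ _) _; have := Piter_step (n + e) ltid.
  by rewrite addnS -tech_pow_Rmult; lra.
have := A_ge0; have := pow_le (/ 2) (n + (k - n))%N ltac:(lra); rewrite /err; set h := ((/ 2) ^ (n + _)%N)%RR.
by move=> h0 A0; have := Rmult_le_pos _ _ A0 h0; lra.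
Qed.

Lemma mcoeff_cauchy n k i a : (n <= k)%N -> (i < d)%N ->
  (Cnorm ((Piter k i)@_a - (Piter n i)@_a) <= / t ^ mdeg a * err n)%RR.
Proof.
move=> lenk ltid; have p0 := pow_lt t (mdeg a) t_gt0.
have := @pnorm_uniq m t t0 (Piter k i - Piter n i) [:: a] isT.
rewrite rsum_cons rsum_nil mcoeffB => h.
apply: (Rmult_le_reg_r _ _ _ p0).
have -> : (/ t ^ mdeg a * err n * t ^ mdeg a = err n)%RR by field; lra.
by apply: Rle_trans (Piter_cauchy lenk ltid); lra.
Qed.

Lemma exists_limit : exists p : nat -> 'X_{1..m} -> C,
  forall i a, (i < d)%N -> Ccv (fun n => (Piter n i)@_a) (p i a).
Proof.
suff /choice[p hp] : forall i, exists p : 'X_{1..m} -> C, forall a, (i < d)%N -> Ccv (fun n => (Piter n i)@_a) (p a).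
  by exists p => i a; exact: hp.
move=> i; have [ltid|] := ltnP i d; last by exists (fun _ => 0).
suff /choice[p hp] : forall a, exists w, Ccv (fun n => (Piter n i)@_a) w by exists p.
move=> a; have p0 := pow_lt t (mdeg a) t_gt0.
have i0 : (0 < / t ^ mdeg a)%RR by exact: Rinv_0_lt_compat.
have [|eps e0|w hw] := @Ccv_Cauchy (fun n => (Piter n i)@_a) (fun n => / t ^ mdeg a * err n)%RR; last by exists w.
  by move=> n k lenk; exact: mcoeff_cauchy.
have [K hK] := err_small (eps := (eps * t ^ mdeg a)%RR) ltac:(nra).
exists K; have := hK K (leqnn K) => h.
have -> : (eps = / t ^ mdeg a * (eps * t ^ mdeg a))%RR by field; lra.
exact: Rmult_lt_compat_l.
Qed.

(** * The limit power series and the equation it satisfies *)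

Section Limit.
Variable p : nat -> 'X_{1..m} -> C.
Hypothesis hp : forall i a, (i < d)%N -> Ccv (fun n => (Piter n i)@_a) (p i a).

(** The limit is a family of coefficients, not a polynomial, so its distance to an iterate is
    expressed on every finite set of monomials, where sums pass to the limit. *)
Lemma limit_dist n i s : (i < d)%N -> uniq s ->
  (rsum s (fun a => Cnorm (p i a - (Piter n i)@_a)%R * t ^ mdeg a) <= err n)%RR.
Proof.
move=> ltid us; apply: Rle_eps => eps e0.
have [a e ep|K hK] := @rsum_small _ s
    (fun a k => Cnorm (p i a - (Piter k i)@_a)%R * t ^ mdeg a)%RR _ eps e0.
  have p0 := pow_lt t (mdeg a) t_gt0.
  have [K hK] := @hp i a ltid (e / t ^ mdeg a)%RR
     ltac:(apply: Rmult_lt_0_compat => //; exact: Rinv_0_lt_compat).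
  exists K => k /hK h; rewrite CnormB.
  have -> : (e = e / t ^ mdeg a * t ^ mdeg a)%RR by field; lra.
  by apply: Rmult_le_compat_r; lra.
set k := maxn K n.
have h1 := hK k (leq_maxl _ _).
have h2 := Piter_cauchy (leq_maxr K n) ltid.
have h3 := @pnorm_uniq m t t0 (Piter k i - Piter n i) s us.
have h4 : (rsum s (fun a => Cnorm (p i a - (Piter n i)@_a)%R * t ^ mdeg a) <=
  rsum s (fun a => Cnorm (p i a - (Piter k i)@_a)%R * t ^ mdeg a) +
  rsum s (fun a => Cnorm (Piter k i - Piter n i)@_a * t ^ mdeg a))%RR.
  rewrite -rsumD; apply: rsum_le => a; rewrite -Rmult_plus_distr_r mcoeffB.
  by apply: Rmult_le_compat_r; [exact: pow_le | exact: Cnorm_tri].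
apply: Rle_trans h4 _.
by apply: Rle_trans (Rplus_le_compat _ _ _ _ h1 (Rle_trans _ _ _ h3 h2)) _; lra.
Qed.

Definition cP (a : nat -> nat) : vec := fun i => p i (mnm m a).
Let W := (err 0 + rho)%RR.

(** The limit has weighted norm at most err 0 + rho at radius t, by comparison with [Piter 0]; each
    degree layer is part of it, which gives growth rate 1/t. *)
Lemma cP_mass i k : (i < d)%N -> (mass m (coef_of cP i) k <= W * (/ t) ^ k)%RR.
Proof.
move=> ltid; have p0 := pow_lt t k t_gt0.
have W0 : (0 <= W)%RR by rewrite /W; have := err_ge0 0; lra.
suff h : (mass m (coef_of cP i) k * t ^ k <= W)%RR.
  apply: (Rmult_le_reg_r _ _ _ p0); rewrite Rmult_assoc -Rpow_mult_distr Rinv_l ?pow1; first lra.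
  by have := t_gt0; lra.
apply: (@Rle_trans _ (rsum (flat m k.+1) (fun a => Cnorm (p i a) * t ^ mdeg a))%RR).
  rewrite rsum_flat rsum_iotaS.
  have -> : (mass m (coef_of cP i) k * t ^ k)%RR =
     rsum (mi m k) (fun x => Cnorm (p i (mnm m x)) * t ^ mdeg (mnm m x))%RR.
    rewrite /mass Rmult_comm -rsumZ; apply: eq_rsum_all (mi_mabs m k) _ => x /eqP xk.
    by rewrite mabs_mnm xk Rmult_comm.
  have : (0 <= rsum (iota 0 k) (fun k => rsum (mi m k) (fun x => Cnorm (p i (mnm m x)) * t ^ mdeg (mnm m x))))%RR.
    apply: rsum_ge0 => k'; apply: rsum_ge0 => x; apply: Rmult_le_pos; first exact: Cnorm_ge0.
    exact: pow_le.
  lra.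
apply: (@Rle_trans _ (rsum (flat m k.+1) (fun a => Cnorm (p i a - (Piter 0 i)@_a)%R * t ^ mdeg a)
    + rsum (flat m k.+1) (fun a => Cnorm (Piter 0 i)@_a * t ^ mdeg a))%RR).
  rewrite -rsumD; apply: rsum_le => a; rewrite -Rmult_plus_distr_r.
  apply: Rmult_le_compat_r; first exact: pow_le.
  by have := Cnorm_tri (Piter 0 i)@_a (p i a) 0; rewrite !subr0.
rewrite /W; apply: Rplus_le_compat; first exact: (limit_dist 0 ltid (flat_uniq m k.+1)).
exact: Rle_trans (pnorm_uniq t0 (Piter 0 i) (flat_uniq m k.+1)) (Piter_le 0 ltid).
Qed.

Variables (P : vec -> vec).
Hypothesis psP : pseries m d P cP W (/ t) (/ (2 * / t)).

Lemma P_dist n i (z : vec) : (i < d)%N -> (forall j, (j < m)%N -> Cnorm (z j) <= t / 4)%RR ->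
  (Cnorm (P z i - pev (Piter n) z i) <= err n)%RR.
Proof.
move=> ltid zt; have tp := t_gt0.
have rE : (/ (2 * / t) = t / 2)%RR by field; lra.
have zt' j : (j < m)%N -> (Cnorm (z j) < / (2 * / t))%RR by rewrite rE => /zt; lra.
(* Past the size of the iterate, truncating it changes nothing, so only the truncated series of P
   has to be compared with it. *)
apply: Ccv_le (ps_val psP zt' ltid) _; exists (msize (Piter n i)) => K leK.
rewrite /pev (meval_hom z leK) -sumrB.
have -> : \sum_(k <- iota 0 K) (chom m (coef_of cP i) k z -
     hom idC m (fun x : nat -> nat => (Piter n i)@_(mnm m x)) k z) =
   \sum_(a <- flat m K) (p i a - (Piter n i)@_a) * xpow m z (ext a).
  rewrite sum_flat; apply: eq_bigr => k _; rewrite /hom -sumrB; apply: eq_bigr => x _.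
  by rewrite -mulrBl xpow_mnm.
apply: Rle_trans (Cnorm_sum _ _) _; apply: Rle_trans (limit_dist n ltid (flat_uniq m K)).
apply: rsum_le => a; rewrite CnormM; apply: Rmult_le_compat_l; first exact: Cnorm_ge0.
rewrite -mabs_ext; apply: Cnorm_xpow => // j /zt; lra.
Qed.

Lemma P_const i : (i < d)%N -> const (coef_of cP i) = 0.
Proof.
move=> ltid; apply: Ccv_unique (hp _ ltid) _.
apply: eq_Ccv (Ccv_const 0) => n; rewrite Piter_low1 // mabs_mnm mabsE big1 //.
Qed.

Lemma P_lin i q : (i < d)%N -> (q < m)%N -> cP (unit_mi q) i = v q i.
Proof.
move=> ltid ltqm; apply: Ccv_unique (hp _ ltid) _.
apply: eq_Ccv (Ccv_const _) => n; rewrite Piter_low ?mnm_unit //.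
rewrite -(mcoeff_linpart i (Ordinal ltqm)); congr (_@_ _); apply/mnmP => k.
rewrite mnm1E mnmE /unit_mi -val_eqE /= eq_sym.
by case: Nat.eqb_spec => [->|/eqP/negPf ->]; rewrite ?eqxx.
Qed.

Lemma P_solves (z : vec) j : (forall i, (i < m)%N -> Cnorm (z i) <= t / 4)%RR -> (j < d)%N ->
  Zcomp d N Z P lam z j = 0.
Proof.
move=> zt ltjd; have tp := t_gt0.
pose xi := blocks d N (fun k => P (Lampow lam k z)).
pose x n := blocks d N (fun k => pev (Piter n) (Lampow lam k z)).
have xd n q : (q < D)%N -> (Cnorm (xi q - x n q) <= err n)%RR.
  rewrite /xi /x.
  apply: (@blocks_ind d N (fun q w => Cnorm (w - x n q) <= err n)%RR) => k i lek ltid.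
  by rewrite /x blocksE //; apply: P_dist => //; exact: Lampow_le.
have xr n q : (q < D)%N -> (Cnorm (x n q) <= rho)%RR.
  move: q; apply: (@blocks_ind d N (fun q w => Cnorm w <= rho)%RR) => k i lek ltid.
  apply: Rle_trans (Piter_le n ltid); apply: meval_le => // i' /(Lampow_le k zt); lra.
have xir q : (q < D)%N -> (Cnorm (xi q) <= rho)%RR.
  move=> ltq; apply: Rle_eps => eps e0; have [K hK] := err_small e0.
  have := hK K (leqnn K); have := xd K q ltq; have := xr K q ltq.
  by have := Cnorm_tri (x K q) (xi q) 0; rewrite !subr0; lra.
have xir0 q : (q < D)%N -> (Cnorm (xi q) < r0)%RR by move=> /xir; lra.
have := ps_nonlin psZ xir0 ltjd; rewrite c0 // add0r => cv.
(* It remains to show that the truncated nonlinear parts of Z at [xi] tend to minus the linear part;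
   they also tend to Z(xi) minus the linear part. *)
apply/(subIr (lin D (coef_of c j) xi)); rewrite sub0r.
apply: Ccv_unique cv _ => eps e0.
pose G := (l * Rc + kap * rho)%RR.
have G0 : (0 <= G)%RR.
  by rewrite /G; have := Rmult_le_pos _ _ l0 Rc0; have := Rmult_le_pos _ _ kap_ge0 (Rlt_le _ _ (proj1 rho0)); lra.
have [K hK] := err_small (eps := (eps / (G + 1))%RR)
  ltac:(apply: Rmult_lt_0_compat => //; apply: Rinv_0_lt_compat; lra).
exists K => n leKn; rewrite opprK.
(* The exact identity of step n. Replacing both iterates by [xi] costs at most a constant times
   [err n]. *)
have e1 : cnonlin D (coef_of c j) n (x n) + lin D (coef_of c j) (x n.+1) = 0.
  by rewrite /x -meval_nonlin -meval_Lop // Lop_Piter // mevalN /Fiter addrN.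
have -> : cnonlin D (coef_of c j) n xi + lin D (coef_of c j) xi =
   (cnonlin D (coef_of c j) n xi - cnonlin D (coef_of c j) n (x n)) +
   lin D (coef_of c j) (vsub xi (x n.+1)).
  rewrite -linB; transitivity (cnonlin D (coef_of c j) n xi + lin D (coef_of c j) xi - 0).
    by rewrite subr0.
  by rewrite -e1; cring.
have h1 : (Cnorm (cnonlin D (coef_of c j) n xi - cnonlin D (coef_of c j) n (x n)) <= kap * rho * err n)%RR.
  apply: (cnonlin_lip psZ) => //; first lra.
    by move=> q ltq; split; [exact: xir | split; [exact: xr | exact: xd]].
  exact: err_ge0.
have h2 : (Cnorm (lin D (coef_of c j) (vsub xi (x n.+1))) <= l * Rc * err n)%RR.
  apply: lin_le => //; first exact: err_ge0.
  move=> q ltq; apply: Rle_trans (xd n.+1 q ltq) _; rewrite /err -tech_pow_Rmult.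
  by have := err_ge0 n; rewrite /err; lra.
apply: Rle_lt_trans (CnormD _ _) _.
apply: (@Rle_lt_trans _ ((G + 1) * err n)%RR).
  by rewrite /G; have := err_ge0 n; lra.
have -> : (eps = (G + 1) * (eps / (G + 1)))%RR by field; lra.
by apply: Rmult_lt_compat_l; [lra | exact: hK].
Qed.

End Limit.
End Iteration.
Lemma invariance_exists : exists P cP l' R' r',
  pseries m d P cP l' R' r' /\
  (forall i, (i < d)%N -> const (coef_of cP i) = 0) /\
  (forall i q, (i < d)%N -> (q < m)%N -> cP (unit_mi q) i = v q i) /\
  exists r, (0 < r)%RR /\ forall z : vec, (forall i, (i < m)%N -> Cnorm (z i) <= r)%RR ->
    forall j, (j < d)%N -> Zcomp d N Z P lam z j = 0.
Proof.
have [S [M [M0 [SM [Slow TS]]]]] := exists_Tinv B0 lam_lt1 nonres.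
have kap0 : (0 <= INR d * M * (8 * l * Rc * Rc))%RR.
  by apply: Rmult_le_pos; [exact: dM_ge0 | exact: kap_ge0].
have e4 : (0 < / 4)%RR by lra.
(* The two bounds by 1/4 become the hypotheses [Rrho] and [Grho] of the iteration. *)
have [rr [rr0 hrr]] := exists_small Rc0 kap0 (ps_r0 psZ) Rlt_0_1 e4 e4.
have [h1 [_ [h2 h3]]] := hrr rr ltac:(lra).
pose sv := (rsum (iota 0 d) (fun i => rsum (iota 0 m) (fun q => Cnorm (v q i))) + 1)%RR.
have sv0 : (0 < sv)%RR := sv_gt0.
pose t := (rr / (2 * sv))%RR.
have tE : (rr = 2 * sv * t)%RR by rewrite /t; field; lra.
have rr1 := conj rr0 h1.
have [p hp] := exists_limit M0 SM rr1 (Rlt_le _ _ h2) (Rlt_le _ _ h3) tE.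
have tp := t_gt0 rr1 tE.
have [P psP] := pseries_exists (c := cP p) (n := m) (p := d)
   (l := (err M 0 + rr)%RR) (Rc := (/ t)%RR)
   ltac:(have := err_ge0 M0 0; lra) (Rinv_0_lt_compat _ tp)
   (fun j k ltjd => cP_mass M0 SM rr1 (Rlt_le _ _ h2) (Rlt_le _ _ h3) tE hp k ltjd).
exists P, (cP p), (err M 0 + rr)%RR, (/ t)%RR, (/ (2 * / t))%RR; split=> //.
split; first by move=> i; exact: (P_const Slow hp).
split; first by move=> i q; exact: (P_lin Slow hp).
exists (t / 4)%RR; split; first lra.
move=> z zt j; exact: (P_solves M0 SM Slow TS rr1 (Rlt_le _ _ h2) (Rlt_le _ _ h3) tE hp psP zt).
Qed.

Lemma lin_blocks_hom j n (w : (nat -> nat) -> vec) (z : vec) : (j < d)%N ->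
  lin D (coef_of c j) (blocks d N (fun k i => chom m (coef_of w i) n (Lampow lam k z))) =
  chom m (fun (a : nat -> nat) => \sum_(i <- iota 0 d) Tmat N B (xpow m lam a) j i * w a i) n z.
Proof.
move=> ltjd; rewrite lin_blocks // exchange_big /= /hom.
under [RHS]eq_bigr do rewrite mulr_suml.
rewrite [RHS]exchange_big; apply: eq_bigr => i _.
under [LHS]eq_bigr do rewrite mulr_sumr.
rewrite [LHS]exchange_big; apply: eq_bigr => a _.
rewrite TmatE !mulr_suml; apply: eq_bigr => k _; rewrite xpow_Lampow /coef_of /idC; cring.
Qed.

(** * Uniqueness, degree by degree *)

Section Uniqueness.
Variables (P Q : vec -> vec) (p q : (nat -> nat) -> vec) (L R' r' rs : R).
Hypothesis psP : pseries m d P p L R' r'.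
Hypothesis psQ : pseries m d Q q L R' r'.
Hypothesis pq0 : forall i, (i < d)%N -> const (coef_of p i) = 0 /\ const (coef_of q i) = 0.
Hypothesis pq1 : forall i k, (i < d)%N -> (k < m)%N -> p (unit_mi k) i = q (unit_mi k) i.
Hypothesis rs0 : (0 < rs)%RR.
Hypothesis solP : forall z : vec, (forall i, (i < m)%N -> Cnorm (z i) < rs)%RR ->
  forall j, (j < d)%N -> Zcomp d N Z P lam z j = 0.
Hypothesis solQ : forall z : vec, (forall i, (i < m)%N -> Cnorm (z i) < rs)%RR ->
  forall j, (j < d)%N -> Zcomp d N Z Q lam z j = 0.
Let L0 := ps_l0 psP.
Let R0 := ps_R0 psP.
Let w (a : nat -> nat) : vec := fun i => q a i - p a i.

Lemma hom_w n i (z : vec) :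
  chom m (coef_of w i) n z = chom m (coef_of q i) n z - chom m (coef_of p i) n z.
Proof.
by rewrite /hom -sumrB; apply: eq_bigr => a _; rewrite -mulrBl.
Qed.

(* If W = Q - P starts in degree n with W_n, then sum_k B_k W_n(Lambda^k z) is
   homogeneous of degree n and O(|z|^(n+1)), hence zero. *)
Lemma coef_eq_step n : (1 < n)%N ->
  (forall k i, (k < n)%N -> (i < d)%N -> all (fun (a : nat -> nat) => w a i == 0) (mi m k)) ->
  forall i, (i < d)%N -> all (fun (a : nat -> nat) => w a i == 0) (mi m n).
Proof.
move=> ge2 IH.
have homeq k i z : (k < n)%N -> (i < d)%N -> chom m (coef_of q i) k z = chom m (coef_of p i) k z.
  move=> ltkn ltid; apply: (eq_sum_all (IH k i ltkn ltid)) => a /eqP wa0; congr (_ * _).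
  exact: subr0_eq.
(* On |z| <= rho both solutions are bounded by A1 rho, since they vanish at 0. If their coefficients
   agree below degree k, the difference is at most An k rho^k, the sum of two tails. *)
pose A1 := (2 * L * R' ^ 1 + 1)%RR.
pose An k := (4 * L * R' ^ k)%RR.
have An0 k : (0 <= An k)%RR.
  by apply: Rmult_le_pos; [lra | exact: pow_le].
have A10 : (0 < A1)%RR.
  by rewrite /A1; have := Rmult_le_pos _ _ L0 (pow_le R' 1 R0); lra.
pose kap := (8 * l * Rc * Rc)%RR.
have kap0 : (0 <= kap)%RR by exact: kap_ge0.
have RcA0 : (0 <= Rc * A1)%RR by apply: Rmult_le_pos; lra.
have e4 : (0 < / 4)%RR by lra.
(* The bound 1/2 makes the tails of P and Q geometric; [r0] keeps their values in the domain of
   Z. *)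
have e2 : (0 < Rmin (/ 2) r0)%RR by apply: Rmin_glb_lt; [lra | exact: (ps_r0 psZ)].
have [rr [rr0 hrr]] := exists_small (G1 := (R' + A1)%RR) (G2 := (Rc * A1)%RR)
  ltac:(lra) RcA0 (ps_r0 psP) rs0 e2 e4.
(* First the nonlinear part of Z(y) - Z(x), then the linear part of Z applied to what remains of y -
   x beyond degree n. *)
pose G := (kap * A1 * An n + l * Rc * An n.+1)%RR.
have ghom j : (j < d)%N ->
   all (fun (a : nat -> nat) => \sum_(i <- iota 0 d) Tmat N B (xpow m lam a) j i * w a i == 0) (mi m n).
  move=> ltjd; apply: (@hom_small_eq0 m n _ G rr rr0) => rho z [rho0 rhor] zr.
  have [b1 [b2 [b3 b4]]] := hrr rho ltac:(lra).
  have b5 : ((R' + A1) * rho < / 2)%RR by apply: Rlt_le_trans b3 (Rmin_l _ _).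
  have b6 : ((R' + A1) * rho < r0)%RR by apply: Rlt_le_trans b3 (Rmin_r _ _).
  have R'rho : (0 <= R' * rho)%RR by apply: Rmult_le_pos; lra.
  have A1rho : (0 < A1 * rho)%RR by apply: Rmult_lt_0_compat.
  have Rr2 : (R' * rho <= / 2)%RR by lra.
  have rho01 : (0 <= rho < r')%RR by lra.
  have zk k := @Lampow_le k z rho zr.
  have size1 F f k i : pseries m d F f L R' r' -> const (coef_of f i) = 0 -> (i < d)%N ->
      (Cnorm (F (Lampow lam k z) i) <= A1 * rho)%RR.
    move=> psF f0 ltid; have := ps_tail psF 1 ltid rho01 Rr2 (zk k).
    rewrite /= big_seq1 hom_0 f0 subr0 /A1 => h; apply: Rle_trans h _; rewrite /=; nra.
  have tails F f k i e : pseries m d F f L R' r' -> (i < d)%N ->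
     (Cnorm (F (Lampow lam k z) i - \sum_(k0 <- iota 0 e) chom m (coef_of f i) k0 (Lampow lam k z)) <=
        2 * L * R' ^ e * rho ^ e)%RR.
    by move=> psF ltid; exact: (ps_tail psF e ltid rho01 Rr2 (zk k)).
  pose x := blocks d N (fun k => P (Lampow lam k z)).
  pose y := blocks d N (fun k => Q (Lampow lam k z)).
  pose hh := blocks d N (fun k i => chom m (coef_of w i) n (Lampow lam k z)).
  have xb u : (u < D)%N -> (Cnorm (x u) <= A1 * rho)%RR.
    move: u; apply: (@blocks_ind d N (fun u s => Cnorm s <= A1 * rho)%RR) => k i _ ltid.
    by apply: (size1 P p) => //; have [] := pq0 ltid.
  have yb u : (u < D)%N -> (Cnorm (y u) <= A1 * rho)%RR.
    move: u; apply: (@blocks_ind d N (fun u s => Cnorm s <= A1 * rho)%RR) => k i _ ltid.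
    by apply: (size1 Q q) => //; have [] := pq0 ltid.
  have yx u : (u < D)%N -> (Cnorm (y u - x u) <= An n * rho ^ n)%RR.
    apply: (@blocks_ind d N (fun u s => Cnorm (s - x u) <= An n * rho ^ n)%RR) => k i lek ltid.
    rewrite /x blocksE //.
    have t1 := tails P p k i n psP ltid; have t2 := tails Q q k i n psQ ltid.
    rewrite (eq_big_seq (fun k0 => chom m (coef_of p i) k0 (Lampow lam k z))) in t2; last first.
      by move=> k0; rewrite mem_iota => /andP[_ ltk0] /=; exact: homeq.
    apply: Rle_trans (Cnorm_trir (\sum_(k0 <- iota 0 n) chom m (coef_of p i) k0 (Lampow lam k z)) _ _) _.
    apply: Rle_trans (Rplus_le_compat _ _ _ _ t2 t1) _; rewrite /An; lra.
  have yxh u : (u < D)%N -> (Cnorm (vsub (vsub y x) hh u) <= An n.+1 * rho ^ n.+1)%RR.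
    have -> : vsub (vsub y x) hh u = y u - x u - hh u by [].
    move: u; apply: (@blocks_ind d N (fun u s => Cnorm (s - x u - hh u) <= An n.+1 * rho ^ n.+1)%RR) => k i lek ltid.
    rewrite /x /hh !blocksE // hom_w.
    have t1 := tails P p k i n.+1 psP ltid; have t2 := tails Q q k i n.+1 psQ ltid.
    rewrite sum_iotaS in t1; rewrite sum_iotaS in t2.
    rewrite (eq_big_seq (fun k0 => chom m (coef_of p i) k0 (Lampow lam k z))) in t2; last first.
      by move=> k0; rewrite mem_iota => /andP[_ ltk0] /=; exact: homeq.
    set Sm := \sum_(k0 <- iota 0 n) _ in t1 t2.
    set hp := chom m (coef_of p i) n _ in t1 *; set hq := chom m (coef_of q i) n _ in t2 *.
    have -> : Q (Lampow lam k z) i - P (Lampow lam k z) i - (hq - hp) =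
      (Q (Lampow lam k z) i - (Sm + hq)) - (P (Lampow lam k z) i - (Sm + hp)) by cring.
    apply: Rle_trans (CnormD _ _) _; rewrite CnormN.
    apply: Rle_trans (Rplus_le_compat _ _ _ _ t2 t1) _; rewrite /An; lra.
  have zs i : (i < m)%N -> (Cnorm (z i) < rs)%RR by move=> /zr; lra.
  have rn := pow_le rho n (Rlt_le _ _ rho0).
  have rn1 := pow_le rho n.+1 (Rlt_le _ _ rho0).
  have dl0 : (0 <= An n * rho ^ n)%RR by exact: Rmult_le_pos.
  have := ps_lip psZ (rho := (A1 * rho)%RR) (dl := (An n * rho ^ n)%RR) (x := y) (y := x) ltjd.
  move=> /(_ _ _ _ dl0) h.
  have {}h : (Cnorm (Z y j - Z x j - lin D (coef_of c j) (vsub y x)) <=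
     8 * l * Rc * Rc * (A1 * rho) * (An n * rho ^ n))%RR.
    apply: h; first by split; lra.
      by rewrite -Rmult_assoc; lra.
    by move=> u ltu; split; [exact: yb | split; [exact: xb | exact: yx]].
  have Zy : Z y j = 0 by exact: solQ.
  have Zx : Z x j = 0 by exact: solP.
  rewrite Zy Zx subr0 sub0r CnormN in h.
  rewrite -(lin_blocks_hom n w z ltjd) -/hh.
  have -> : lin D (coef_of c j) hh = lin D (coef_of c j) (vsub y x) -
     lin D (coef_of c j) (vsub (vsub y x) hh) by rewrite -[lin _ _ (vsub _ hh)]linB subKr.
  apply: Rle_trans (CnormD _ _) _; rewrite CnormN.
  have h2 := lin_le (x := vsub (vsub y x) hh) ltjd (Rmult_le_pos _ _ (An0 n.+1) rn1) yxh.
  apply: Rle_trans (Rplus_le_compat _ _ _ _ h h2) _.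
  by rewrite /G /kap -tech_pow_Rmult; apply: Req_le; ring.
move=> i ltid; apply/(all_nthP (fun _ => 0%N)) => s lts; apply/eqP.
set a := nth _ _ s.
have an : mabs m a = n by have /(all_nthP (fun _ => 0%N))/(_ s lts)/eqP := mi_mabs m n.
have := @left_inv_eq0 d (Tmat N B (xpow m lam a)) (w a) _ _ i ltid; apply.
  by apply: nonres; rewrite an.
move=> j ltjd; have /(all_nthP (fun _ => 0%N))/(_ s lts)/eqP := ghom j ltjd.
by [].
Qed.

(** Degrees 0 and 1 agree by the normalization of value and derivative; [coef_eq_step] handles the
    rest. *)
Lemma coef_eq n i : (i < d)%N -> all (fun (a : nat -> nat) => w a i == 0) (mi m n).
Proof.
elim/ltn_ind: n i => n IH i ltid.
have [lt2|ge2] := ltnP 1 n; first exact: (coef_eq_step lt2 (fun k i ltkn ltid => IH k ltkn i ltid)).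
case: n ge2 {IH} => [|[|//]] _.
  rewrite mi0 /= andbT /w; have [] := pq0 ltid; rewrite /const /coef_of => -> ->.
  by rewrite subrr.
rewrite mi1 all_map; apply/allP => k; rewrite mem_iota => /andP[_ ltkm].
by rewrite /= /w pq1 // subrr.
Qed.

Lemma invariance_unique (z : vec) i : (forall k, (k < m)%N -> Cnorm (z k) < r')%RR ->
  (i < d)%N -> Q z i = P z i.
Proof.
move=> zr ltid; apply: Ccv_unique (ps_val psQ zr ltid) _.
apply: eq_Ccv (ps_val psP zr ltid) => K; apply: eq_bigr => k _.
apply: (eq_sum_all (coef_eq k ltid)) => a /eqP wa0; congr (_ * _).
by symmetry; exact: subr0_eq.
Qed.

End Uniqueness.
End Invariance.

(** * The matrices B_k as linear coefficients of Z *)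

Lemma in_block_axis d N k i s : (k <= N)%N -> (i < d)%N ->
  in_block d N k (axis i s) = axis (k * d + i)%N s.
Proof.
move=> lekN ltid; apply: funext => u; rewrite {2}/axis.
have [->|ne] := eqVneq u (k * d + i)%N.
  by rewrite /in_block blocksE // Nat.eqb_refl /axis eqxx.
have [ltu|geu] := ltnP u (N.+1 * d); last first.
  rewrite /in_block /blocks; case: Nat.ltb_spec0 => // /ltP.
  by rewrite ltnNge geu.
have d0 : (0 < d)%N by exact: leq_ltn_trans ltid.
have ltm : (u %% d < d)%N by rewrite ltn_mod.
have leN : (u %/ d <= N)%N by rewrite -ltnS ltn_divLR.
rewrite /in_block [in LHS](divn_eq u d) blocksE //.
case: Nat.eqb_spec => // e; rewrite /axis; case: eqP => // e'.
by move: ne; rewrite (divn_eq u d) e e' eqxx.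
Qed.

Lemma in_block0 d N k : in_block d N k vzero = vzero.
Proof.
by apply: funext => u; rewrite /in_block /blocks; case: Nat.ltb => //; case: Nat.eqb.
Qed.

Lemma block_coef d N Z c l Rc r0 (A : mat) k i j :
  pseries (N.+1 * d) d Z c l Rc r0 ->
  has_deriv0 d d (fun h => Z (in_block d N k h)) A ->
  (k <= N)%N -> (i < d)%N -> (j < d)%N -> c (unit_mi (k * d + i)%N) j = A j i.
Proof.
move=> ps dA lekN ltid ltjd; have [rho [[rho0 rhor] Rr]] := exists_rho ps.
have h := deriv_coef (A := (8 * l * Rc * Rc)%RR) (w := c (unit_mi (k * d + i)%N) j)
  dA ltid ltjd rho0.
symmetry; apply: h => s [sp srho]; rewrite in_block0 in_block_axis //.
have ltu : (k * d + i < N.+1 * d)%N.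
  by apply: (@leq_trans (k.+1 * d)); [rewrite mulSn addnC ltn_add2r | rewrite leq_mul2r ltnS lekN orbT].
have -> : c (unit_mi (k * d + i)%N) j * mkC s 0 =
    lin (N.+1 * d) (coef_of c j) (vsub (axis (k * d + i)%N s) vzero).
  by rewrite -linB lin0 subr0 /lin (sum_axis s (fun u => coef_of c j (unit_mi u)) ltu).
have R0 := ps_R0 ps; apply: (ps_lip ps) => //; try lra.
  by apply: Rle_trans Rr; apply: Rmult_le_compat_l; lra.
move=> u _; rewrite /vzero subr0 Cnorm0; have := @Cnorm_axis (k * d + i)%N s u; lra.
Qed.

(** The second solution comes with its own constants; the uniqueness argument works with one triple
    for both. *)
Lemma pseries_common n p f g c c' l l' Rc Rc' r r' :
  pseries n p f c l Rc r -> pseries n p g c' l' Rc' r' ->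
  exists L R' s, pseries n p f c L R' s /\ pseries n p g c' L R' s.
Proof.
move=> pf pg; have r0 := ps_r0 pf; have r0' := ps_r0 pg.
have m0 : (0 < Rmin r r')%RR by exact: Rmin_glb_lt.
exists (Rmax l l'), (Rmax Rc Rc'), (Rmin r r'); split.
  by apply: pseries_weaken pf _ _ (conj m0 (Rmin_l _ _)); exact: Rmax_l.
by apply: pseries_weaken pg _ _ (conj m0 (Rmin_r _ _)); exact: Rmax_r.
Qed.

End PowerSeries.

Import PowerSeries.
Open Scope R_scope.

Theorem mainTheorem8
  (d N m : nat) (Z : vec -> vec) (B : nat -> mat) (lam : vec) (v : nat -> vec) :
  analytic0 (S N * d) d Z ->
  (forall i, (i < d)%nat -> Z vzero i = C0) ->
  (forall k, (k <= N)%nat -> has_deriv0 d d (fun h => Z (in_block d N k h)) (B k)) ->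
  det d (B 0%nat) <> C0 ->
  stable_nonresonant d N B m lam ->
  (forall j, (j < m)%nat ->
     (forall i, (i < d)%nat -> matvec d (Tmat N B (lam j)) (v j) i = C0) /\
     (exists i, (i < d)%nat /\ v j i <> C0)) ->
  let V : mat := fun i j => v j i in
  exists P : vec -> vec,
    analytic0 m d P /\
    (forall i, (i < d)%nat -> P vzero i = C0) /\
    has_deriv0 m d P V /\
    solves d N m Z P lam /\
    (forall Q : vec -> vec,
       analytic0 m d Q ->
       (forall i, (i < d)%nat -> Q vzero i = C0) ->
       has_deriv0 m d Q V ->
       solves d N m Z Q lam ->
       exists r, 0 < r /\ forall z : vec, vnorm m z < r ->
         forall i, (i < d)%nat -> Q z i = P z i).
Proof.
move=> aZ Z0 dZ dB0 [lamH nonresH] eigH V.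
have [c [l [Rc [r0 psZ]]]] := analytic_pseries aZ.
have c0 j (ltjd : ssrnat.leq (S j) d) : const (coef_of c j) = C0.
  by rewrite -(ps_zero psZ ltjd); apply/Z0/ssrnat.ltP.
have cB k i j (lekN : ssrnat.leq k N) (ltid : ssrnat.leq (S i) d) (ltjd : ssrnat.leq (S j) d) :=
  block_coef psZ (dZ k (elimT ssrnat.leP lekN)) lekN ltid ltjd.
have lam1 j (ltjm : ssrnat.leq (S j) m) : Cnorm (lam j) < 1.
  by have [] := lamH j (elimT ssrnat.ltP ltjm).
have nonres a (ge2 : ssrnat.leq 2 (mabs m a)) : det d (Tmat N B (xpow m lam a)) <> C0.
  by rewrite -monomialE; apply: nonresH; apply/ssrnat.leP.
have eig q i (ltqm : ssrnat.leq (S q) m) (ltid : ssrnat.leq (S i) d) :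
    matvec d (Tmat N B (lam q)) (v q) i = C0.
  by have [h _] := eigH q (elimT ssrnat.ltP ltqm); apply/h/ssrnat.ltP.
have eig' q i (ltqm : ssrnat.leq (S q) m) (ltid : ssrnat.leq (S i) d) :=
  eq_trans (eq_sym (sumCE d (fun k => Cmul (Tmat N B (lam q) i k) (v q k)))) (eig q i ltqm ltid).
have [P [cP [lp [Rp [rp [psP [cP0 [cP1 [rs [rs0 solP]]]]]]]]]] :=
  invariance_exists psZ c0 cB dB0 lam1 nonres eig'.
exists P; split; first exact: (pseries_analytic psP).
split=> [i /ssrnat.ltP ltid|]; first by rewrite (ps_zero psP ltid) cP0.
split; first by apply: (ps_deriv psP) => j q ltjd ltqm; rewrite cP1.
split.
  exists rs; split=> // z zr i /ssrnat.ltP ltid; apply: solP => // k ltkm.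
  by apply: Rle_trans (le_vnorm z ltkm) (Rlt_le _ _ zr).
move=> Q aQ Q0 dQ [rq [rq0 solQ]].
have [q [lq [Rq [rq' psQ]]]] := analytic_pseries aQ.
have [L [R' [r' [psP' psQ']]]] := pseries_common psP psQ.
exists r'; split; first exact: (ps_r0 psP').
move=> z zr i /ssrnat.ltP ltid.
(* Componentwise strict bounds give only a weak bound on [vnorm]; halving [rq] recovers the strict
   one that [solves] asks for. *)
have rr0 : 0 < Rmin rs (rq / 2) by apply: Rmin_glb_lt => //; Lra.lra.
apply: (invariance_unique psZ cB lam1 nonres psP' psQ' _ _ rr0) => //.
- move=> j ltjd; split; first exact: cP0.
  by rewrite -(ps_zero psQ ltjd); apply/Q0/ssrnat.ltP.
- by move=> j k ltjd ltkm; rewrite cP1 // -(ps_deriv_coef psQ dQ ltkm ltjd).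
- move=> y yr j ltjd; apply: solP => // k /yr h.
  exact: Rlt_le (Rlt_le_trans _ _ _ h (Rmin_l _ _)).
- move=> y yr j ltjd; apply: solQ; last by apply/ssrnat.ltP.
  have yb : vnorm m y <= rq / 2.
    apply: vnorm_le => [|k /yr h]; first by Lra.lra.
    exact: Rlt_le (Rlt_le_trans _ _ _ h (Rmin_r _ _)).
  by Lra.lra.
by move=> k ltkm; apply: Rle_lt_trans (le_vnorm z ltkm) zr.
Qed.
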